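(* Suppose $X$ has transition densities $(p_t)_{t\ge1}$ with respect to a measure $\mu$ on $(\mathbb{X},\mathcal{B})$; that is, for each $t=1,2,\dots$, $p_t:\mathbb{X}\times\mathbb{X}\to\mathbb{R}_+$ is a Borel measurable function such that $$\mathbb{P}_x(X_t\in A)=\int_A p_t(x,y)\,\mu(dy),\qquad\forall x\in\mathbb{X},\ A\in\mathcal{B}.$$ For each $i\in\{1,2\}$, assume $f_i\le h_i\le g_i$ on $\mathbb{X}$ and that $(\delta_i(t)g_i(X_t^x))_{t\ge0}$ is a supermartingale for all $x\in\mathbb{X}$. Then there exists a sharp inter-personal equilibrium, i.e. $\widehat{\mathcal{E}}\ne\emptyset$.
   Context: Setting (nonzero-sum Dynkin game). $\mathbb{Z}_+=\{0,1,2,\dots\}$, $\mathbb{N}=\{1,2,\dots\}$. $X=(X_t)_{t\in\mathbb{Z}_+}$ is a time-homogeneous strong Markov process with values in a Polish space $\mathbb{X}$ with Borel $\sigma$-algebra $\mathcal{B}$, on the path space $\Omega$ of functions $\mathbb{Z}_+\to\mathbb{X}$; $(\mathcal{F}_t)$ is the filtration generated by $X$, $\mathcal{T}$ is the set of $(\mathcal{F}_t)$-stopping times (allowed to take the value $+\infty$), $X^x$ is the process $X$ with $X_0=x$, $\mathbb{P}_x$ is its law, and $\mathbb{E}_x$ the corresponding expectation. For $i\in\{1,2\}$: the discount function $\delta_i:\mathbb{Z}_+\to[0,1]$ is strictly decreasing with $\delta_i(0)=1$ and $\delta_i(s)\delta_i(t)\le\delta_i(s+t)$ for all $s,t\in\mathbb{Z}_+$;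 $f_i,g_i,h_i:\mathbb{X}\to\mathbb{R}_+=[0,\infty)$ are Borel measurable with $\mathbb{E}_x\big[\sup_{t\in\mathbb{N}}\delta_i(t)(f_i(X_t)+g_i(X_t)+h_i(X_t))\big]<\infty$ for all $x\in\mathbb{X}$. For $\tau,\sigma\in\mathcal{T}$, $$F_i(\tau,\sigma):=\delta_i(\tau)f_i(X_\tau)1_{\{\tau<\sigma\}}+\delta_i(\sigma)g_i(X_\sigma)1_{\{\tau>\sigma\}}+\delta_i(\tau)h_i(X_\tau)1_{\{\tau=\sigma\}},$$ with $F_i(\tau,\sigma):=\limsup_{t\to\infty}\delta_i(t)h_i(X_t)$ on $\{\tau=\sigma=+\infty\}$, and $J_i(x,\tau,\sigma):=\mathbb{E}_x[F_i(\tau,\sigma)]$. Here $\tau$ is Player $i$'s stopping time and $\sigma$ the other player's. Stopping policies are sets $S\in\mathcal{B}$. Put $\rho_S:=\inf\{t\ge0:X_t\in S\}$ and $\rho_S^+:=\inf\{t>0:X_t\in S\}$ ($\inf\emptyset=\infty$). Equilibria. For $S,T\in\mathcal{B}$ let $$\Theta_i^T(S):=\{x\in S: J_i(x,0,\rho_T)\ge J_i(x,\rho_S^+,\rho_T)\}\cup\{x\notin S: J_i(x,0,\rho_T)>J_i(x,\rho_S^+,\rho_T)\}.$$ $S$ is an intra-personal equilibrium of Player $i$ with respect to $T$ if $\Theta_i^T(S)=S$; $\mathcal{E}_i^T$ is the set of these. For $S\in\mathcal{E}_i^T$ let $U_i^T(x,S):=\max\{J_i(x,0,\rho_T),J_i(x,\rho_S^+,\rho_T)\}$.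 $S\in\mathcal{E}_i^T$ is optimal if $U_i^T(x,S)\ge U_i^T(x,R)$ for all $R\in\mathcal{E}_i^T$ and all $x\in\mathbb{X}$; $\widehat{\mathcal{E}}_i^T$ is the set of optimal ones. $(S,T)\in\mathcal{B}\times\mathcal{B}$ is a sharp inter-personal equilibrium if $S\in\widehat{\mathcal{E}}_1^T$ and $T\in\widehat{\mathcal{E}}_2^S$; $\widehat{\mathcal{E}}$ is the set of sharp inter-personal equilibria.
   Formalization: The measure μ is assumed σ-finite; for an arbitrary measure (e.g. counting measure on an uncountable Polish space) the claim fails. *)

(* Defs.v *)
From HB Require Import structures.
From mathcomp Require Import all_boot all_order all_algebra.
From mathcomp Require Import all_classical all_reals all_analysis.

Set Implicit Arguments.
Unset Strict Implicit.
Unset Printing Implicit Defensive.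

Import Order.TTheory GRing.Theory Num.Theory.
Import numFieldNormedType.Exports.

Local Open Scope classical_set_scope.
Local Open Scope ring_scope.

(* Separable and completely metrizable; only the existence of a compatible
   complete metric is required, no metric is fixed. *)
Definition polish (R : realType) (X : topologicalType) : Prop :=
  (exists2 D : set X, countable D & dense D) /\
  exists d : X -> X -> R,
    [/\ (forall x y, 0 <= d x y) /\ (forall x y, d x y = 0 <-> x = y),
        (forall x y, d x y = d y x) /\
          (forall x y z, d x z <= d x y + d y z),
        forall (x : X) (A : set X),
          nbhs x A <-> exists2 e, 0 < e & [set y | d x y < e] `<=` A
      & forall u : nat -> X,
          (forall e, 0 < e -> exists N, forall m n,
             (N <= m)%N -> (N <= n)%N -> d (u m) (u n) < e) ->
          exists l : X, u @ \oo --> l].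

Definition borel (X : ptopologicalType) := g_sigma_algebraType (@open X).

Section path_space.
Context {X : ptopologicalType}.

Definition coordinate_events (t : nat) : set (set (nat -> borel X)) :=
  preimage_set_system setT (fun w : nat -> borel X => w t) measurable.

Definition cylinders : set (set (nat -> borel X)) :=
  \bigcup_t coordinate_events t.

(* sigma(X_0, ..., X_t) *)
Definition history (t : nat) : set (set (nat -> borel X)) :=
  <<s \bigcup_(s in [set s | (s <= t)%N]) coordinate_events s >>.

End path_space.

Definition path_space (X : ptopologicalType) :=
  g_sigma_algebraType (@cylinders X).

Section stopping_times.
Context {X : ptopologicalType}.
Local Notation Omega := (path_space X).

(* [None] is the value +oo of a random time. *)
Definition random_time := Omega -> option nat.

Definition happens_by (tau : random_time) (t : nat) : set Omega :=
  [set w | exists2 n, tau w = Some n & (n <= t)%N].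

Definition stopping_time (tau : random_time) : Prop :=
  forall t, history t (happens_by tau t).

(* the stopped sigma-algebra F_tau *)
Definition stopped_history (tau : random_time) : set (set Omega) :=
  [set A | measurable A /\ forall t, history t (A `&` happens_by tau t)].

Definition shift (n : nat) (w : Omega) : Omega := fun t => w (n + t)%N.

(* inf { t >= m : w t \in S } *)
Definition hitting_from (m : nat) (S : set (borel X)) : random_time :=
  fun w =>
    match pselect (exists t, (m <= t)%N && (w t \in S)) with
    | left ex => Some (ex_minn ex)
    | right _ => None
    end.

Definition hit : set (borel X) -> random_time := hitting_from 0.
Definition hit_plus : set (borel X) -> random_time := hitting_from 1.

Definition now : random_time := fun=> Some 0%N.

End stopping_times.

Section process.
Context {R : realType} {X : ptopologicalType}.
Local Notation Omega := (path_space X).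
Local Open Scope ereal_scope.

(* Coordinate process on path space, with law [P x] when started at x. *)
Definition strong_markov (P : R.-pker (borel X) ~> Omega) : Prop :=
  (forall x, P x [set w : Omega | w 0%N = x] = 1) /\
  forall (x : borel X) (tau : random_time), stopping_time tau ->
  forall A B : set Omega, stopped_history tau A -> measurable B ->
    P x (A `&` [set w | exists2 n, tau w = Some n & B (shift n w)]) =
    \int[P x]_(w in A `&` [set w | tau w != None])
      P (w (odflt 0%N (tau w))) B.

Definition transition_density (P : R.-pker (borel X) ~> Omega)
    (mu : {measure set (borel X) -> \bar R}) (p : nat -> X -> X -> R) : Prop :=
  forall t, (0 < t)%N ->
    [/\ forall x y, (0 <= p t x y)%R,
        measurable_fun setT
          (fun z : (borel X * borel X)%type => p t z.1 z.2)
      & forall (x : borel X) (A : set (borel X)), measurable A ->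
          P x [set w : Omega | A (w t)] = \int[mu]_(y in A) (p t x y)%:E].

(* C is a version of the conditional expectation of Z given G. *)
Definition cond_expectation (m : {measure set Omega -> \bar R})
    (G : set (set Omega)) (Z C : Omega -> R) : Prop :=
  [/\ forall B : set R, measurable B -> G (C @^-1` B),
      m.-integrable setT (EFin \o C)
    & forall A, G A ->
        \int[m]_(w in A) (C w)%:E = \int[m]_(w in A) (Z w)%:E].

Definition supermartingale (m : {measure set Omega -> \bar R})
    (M : nat -> Omega -> R) : Prop :=
  [/\ forall t (B : set R), measurable B -> history t (M t @^-1` B),
      forall t, m.-integrable setT (EFin \o M t)
    & forall s t, (s <= t)%N ->
        exists2 C, cond_expectation m (history s) (M t) C
                 & {ae m, forall w, (C w <= M s w)%R}].

End process.

(* One player's discount function and payoffs: [lead] (f) is received when the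
   player stops first, [follow] (g) when the opponent stops first and [both]
   (h) when they stop simultaneously. *)
Record payoff (R : realType) (X : Type) := Payoff {
  discount : nat -> R;
  lead : X -> R;
  follow : X -> R;
  both : X -> R
}.

Section game.
Context {R : realType} {X : ptopologicalType}.
Local Notation Omega := (path_space X).
Local Open Scope ereal_scope.
Variable P : R.-pker (borel X) ~> Omega.
Implicit Types (a : payoff R (borel X)) (S T : set (borel X)).

Definition discount_function (delta : nat -> R) : Prop :=
  [/\ forall t, (0 <= delta t <= 1)%R,
      forall s t, (s < t)%N -> (delta t < delta s)%R,
      delta 0%N = 1%R
    & forall s t, (delta s * delta t <= delta (s + t)%N)%R].

Definition admissible a : Prop :=
  [/\ discount_function (discount a),
      forall x, [/\ (0 <= lead a x)%R, (0 <= follow a x)%R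
                  & (0 <= both a x)%R],
      [/\ measurable_fun setT (lead a), measurable_fun setT (follow a)
        & measurable_fun setT (both a)]
    & forall x, \int[P x]_w
        ereal_sup [set (discount a t *
                        (lead a (w t) + follow a (w t) + both a (w t)))%:E
                  | t in [set t | (1 <= t)%N]] < +oo].

(* F(tau, sigma): tau is the player's stopping time, sigma the opponent's. *)
Definition game_payoff a (tau sigma : random_time) (w : Omega) : \bar R :=
  match tau w, sigma w with
  | Some s, Some t =>
      if (s < t)%N then (discount a s * lead a (w s))%:E
      else if (t < s)%N then (discount a t * follow a (w t))%:E
      else (discount a s * both a (w s))%:E
  | Some s, None => (discount a s * lead a (w s))%:E
  | None, Some t => (discount a t * follow a (w t))%:E
  | None, None => limn_esup (fun t => (discount a t * both a (w t))%:E)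
  end.

Definition J a (x : borel X) (tau sigma : random_time) : \bar R :=
  \int[P x]_w game_payoff a tau sigma w.

Definition Theta a T S : set (borel X) :=
  [set x | S x /\ J a x (hit_plus S) (hit T) <= J a x now (hit T)] `|`
  [set x | ~ S x /\ J a x (hit_plus S) (hit T) < J a x now (hit T)].

Definition intra_equilibria a T : set (set (borel X)) :=
  [set S | measurable S /\ Theta a T S = S].

Definition U a T (x : borel X) S : \bar R :=
  maxe (J a x now (hit T)) (J a x (hit_plus S) (hit T)).

Definition optimal_intra_equilibria a T : set (set (borel X)) :=
  [set S | intra_equilibria a T S /\
     forall R', intra_equilibria a T R' -> forall x, U a T x R' <= U a T x S].

Definition sharp_inter_equilibria (a1 a2 : payoff R (borel X)) :
    set (set (borel X) * set (borel X)) :=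
  [set ST | [/\ measurable ST.1, measurable ST.2,
                optimal_intra_equilibria a1 ST.2 ST.1
              & optimal_intra_equilibria a2 ST.1 ST.2]].

End game.

(* Main.v *)
Require Import Defs.
From HB Require Import structures.
From mathcomp Require Import all_boot all_order all_algebra.
From mathcomp Require Import all_classical all_reals all_analysis.
From mathcomp Require Import measurable_realfun.

(** Fix the stopping set [T] of the opponent. Off [T], a policy [S] is worth its
    continuation value [value T S]: the expected payoff collected at the first
    positive time spent in [S] or [T]. Call [S] waiting when [lead <= value T S]
    off [S] and [T]; every intra-personal equilibrium is waiting. Let [Q] be
    contained in all the sets of a sequence such that, at each point off [Q] and
    [T], some set of the sequence makes continuing at least as good as stopping.
    A player heading for one of these sets does not lose by heading for another
    one, over and over, until [Q] or [T] is met: at each change of target, the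
    inequality [discount s * discount t <= discount (s + t)] turns the value of
    continuing into a lower bound for the payoff seen from the starting point
    ([value_improvement]). So waiting policies are stable under countable
    intersections, which raise the value. Thanks to the transition densities,
    continuation values ignore null sets, and an exhaustion argument gives a
    waiting policy that is minimal up to null sets; its value [best T] dominates
    at every point the value of all waiting policies ([best_waiting]). The set
    [response T] of the points off [T] where [lead] exceeds [best T] has the same
    value and is an optimal equilibrium against [T] ([response_optimal]).

    A player benefits from an opponent who stops more often
    ([value_le_opponent]): the reward [follow] comes earlier, it dominates the
    other rewards, and it is a supermartingale once discounted. On paths never
    stopped, this uses the almost sure convergence of the discounted [follow],
    which follows from the upcrossing inequality ([ae_supermartingale_cvg]).
    Hence [best] is monotone in [T], even up to null sets ([best_le]), the
    region where the player wants to stop is antitone, and the composite of the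
    two players' responses is monotone. The theorem of Knaster and Tarski,
    applied in the complete lattice of measurable sets modulo null sets, yields
    two sets that are optimal responses to each other
    ([antitone_fixed_point]). *)

Set Implicit Arguments.
Unset Strict Implicit.
Unset Printing Implicit Defensive.

Import Order.TTheory GRing.Theory Num.Theory.
Import numFieldNormedType.Exports.

Local Open Scope classical_set_scope.
Local Open Scope ring_scope.
Local Open Scope ereal_scope.

(** * Limits, integrals and null sets *)

Section limits.
Context {R : realType}.
Implicit Types u v : (\bar R)^nat.

Lemma limn_esup_le_esups u n : limn_esup u <= esups u n.
Proof.
rewrite limn_esup_lim (cvg_lim _ (@cvg_esups_inf _ u))//.
by apply: ereal_inf_lbound; exists n.
Qed.

Lemma le_limn_esup_lb u c : (forall n, c <= esups u n) -> c <= limn_esup u.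
Proof.
move=> h; rewrite limn_esup_lim (cvg_lim _ (@cvg_esups_inf _ u))//.
by apply: le_ereal_inf_tmp => _ [n _ <-].
Qed.

Lemma esups_ub u n m : (n <= m)%N -> u m <= esups u n.
Proof. by move=> nm; apply: ereal_sup_ubound; exists m. Qed.

Lemma esups_le u n c : (forall m, (n <= m)%N -> u m <= c) -> esups u n <= c.
Proof. by move=> h; apply: ge_ereal_sup => _ [m /= nm <-]; exact: h. Qed.

Lemma einfs_le_limn_einf u n : einfs u n <= limn_einf u.
Proof.
rewrite limn_einf_lim (cvg_lim _ (@cvg_einfs_sup _ u))//.
by apply: ereal_sup_ubound; exists n.
Qed.

Lemma le_einfs u n c : (forall m, (n <= m)%N -> c <= u m) -> c <= einfs u n.
Proof. by move=> h; apply: le_ereal_inf_tmp => _ [m /= nm <-]; exact: h. Qed.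

Lemma limn_einf_le_lim u c :
  (forall n, einfs u n <= c) -> limn_einf u <= c.
Proof.
move=> h; rewrite limn_einf_lim (cvg_lim _ (@cvg_einfs_sup _ u))//.
by apply: ge_ereal_sup => _ [n _ <-].
Qed.

Lemma le_limn_esup u v : (forall n, u n <= v n) -> limn_esup u <= limn_esup v.
Proof.
move=> uv; apply: le_limn_esup_lb => n.
apply: le_trans (limn_esup_le_esups u n) _.
by apply: esups_le => m nm; apply: le_trans (uv m) (esups_ub _ nm).
Qed.

End limits.

Section reverse_fatou.
Context d (T : measurableType d) (R : realType).
Variable m : {measure set T -> \bar R}.

Lemma reverse_fatou (Y : (T -> \bar R)^nat) (Z : T -> \bar R) (c : \bar R) :
  (forall n, measurable_fun setT (Y n)) -> (forall n w, 0 <= Y n w) ->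
  measurable_fun setT Z -> (forall n w, Y n w <= Z w) ->
  \int[m]_w Z w < +oo -> (forall n, c <= \int[m]_w Y n w) ->
  c <= \int[m]_w limn_esup (Y ^~ w).
Proof.
move=> mY Y0 mZ YZ Zoo cY.
have Z0 w : 0 <= Z w by exact: le_trans (Y0 0%N w) (YZ 0%N w).
pose f n w := esups (Y ^~ w) n.
have mf n : measurable_fun setT (f n) by exact: measurable_fun_esups.
have Yf n w : Y n w <= f n w by exact: esups_ub.
have f0 n w : 0 <= f n w by exact: le_trans (Y0 n w) (Yf n w).
have fZ n w : f n w <= Z w by exact: esups_le.
have [|||||_ _ h] := @dominated_convergence _ T R m setT measurableT f
   (fun w => limn_esup (Y ^~ w)) Z.
- exact: mf.
- exact: measurable_fun_limn_esup.
- apply: aeW => w _; rewrite limn_esup_lim; exact: is_cvg_esups.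
- apply/integrableP; split => //.
  by under eq_integral => w _ do rewrite gee0_abs//.
- by apply: aeW => w n _; rewrite gee0_abs.
- rewrite -(cvg_lim _ h)//; apply: lime_ge; first by apply: cvgP h.
  apply: nearW => n; apply: le_trans (cY n) _.
  exact: ge0_le_integral.
Qed.

Lemma fatou_le (Y : (T -> \bar R)^nat) (F : T -> \bar R) (c : \bar R) :
  (forall n, measurable_fun setT (Y n)) -> (forall n w, 0 <= Y n w) ->
  measurable_fun setT F -> (forall w, 0 <= F w) ->
  {ae m, forall w, F w <= limn_einf (Y ^~ w)} ->
  (forall n, \int[m]_w Y n w <= c) -> \int[m]_w F w <= c.
Proof.
move=> mY Y0 mF F0 Fl Yc.
have le0 w : 0 <= limn_einf (Y ^~ w).
  by apply: le_trans (einfs_le_limn_einf _ 0%N); apply: le_einfs => k _.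
apply: (@le_trans _ _ (\int[m]_w limn_einf (Y ^~ w))).
  apply: ae_ge0_le_integral => //.
    rewrite (_ : (fun _ => _) = (fun w => - limn_esup (fun n => - Y n w)))//.
    apply: measurableT_comp => //.
    apply: (measurable_fun_limn_esup (f := fun n w => - Y n w)) => n.
    exact: measurableT_comp.
  by apply: filterS Fl => w Fw _.
apply: le_trans (fatou m measurableT mY (fun n w _ => Y0 n w)) _.
apply: limn_einf_le_lim => n.
by apply: le_trans (Yc n); apply: ereal_inf_lbound; exists n => /=.
Qed.

Lemma ge0_eq_integral_ae (A : set T) (f g : T -> \bar R) :
  measurable_fun setT f -> measurable_fun setT g ->
  (forall w, 0 <= f w) -> (forall w, 0 <= g w) ->
  {ae m, forall w, A w} -> (forall w, A w -> f w = g w) ->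
  \int[m]_w f w = \int[m]_w g w.
Proof.
move=> mf mg f0 g0 mA fg; apply: ge0_ae_eq_integral => //.
by apply: filterS mA => w /fg ? _.
Qed.

(** Two integrals are compared on the only event where the integrands
    differ. *)
Lemma le_integral_off (E : set T) (f g : T -> \bar R) : measurable E ->
  measurable_fun setT f -> measurable_fun setT g ->
  (forall w, 0 <= f w) -> (forall w, 0 <= g w) ->
  (forall w, ~ E w -> f w = g w) ->
  \int[m]_(w in E) f w <= \int[m]_(w in E) g w ->
  \int[m]_w f w <= \int[m]_w g w.
Proof.
move=> mE mf mg f0 g0 fg.
have split_int (k : T -> \bar R) : measurable_fun setT k ->
    (forall w, 0 <= k w) -> \int[m]_w k w =
    \int[m]_(w in E) k w + \int[m]_(w in ~` E) k w.
  move=> mk k0; rewrite -ge0_integral_setU ?setUv//; first exact: measurableC.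
  by apply/disj_setPS; rewrite setICr.
move=> h; rewrite !split_int//; apply: leeD => //.
by rewrite le_eqVlt; apply/orP; left; apply/eqP/eq_integral => w /set_mem /fg.
Qed.

End reverse_fatou.

(** A disintegration of the image of [m] under [phi], given on events, extends
    to nonnegative functions. *)
Section disintegration.
Context d1 d2 (T1 : measurableType d1) (T2 : measurableType d2) (R : realType).
Variables (m : {measure set T1 -> \bar R}) (A : set T1) (mA : measurable A).
Variables (phi : T1 -> T2) (k : T1 -> {measure set T2 -> \bar R}).
Hypothesis mphi : measurable_fun setT phi.
Hypothesis mk : forall B, measurable B -> measurable_fun setT (k ^~ B).
Hypothesis disint : forall B, measurable B ->
  m (A `&` phi @^-1` B) = \int[m]_(w in A) k w B.

Import HBNNSimple.

Let mkA B : measurable B -> measurable_fun A (k ^~ B).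
Proof. by move=> mB; apply: measurable_funS (mk mB). Qed.

Let mphiA : measurable_fun A phi.
Proof. exact: measurable_funS mphi. Qed.

Let mpre B : measurable B -> measurable (phi @^-1` B).
Proof. by move=> mB; rewrite -[X in measurable X]setTI; exact: mphi. Qed.

Let disint_nnsfun (f : {nnsfun T2 >-> R}) :
  \int[m]_(w in A) (f (phi w))%:E = \int[m]_(w in A) \int[k w]_z (f z)%:E.
Proof.
under [in LHS]eq_integral do rewrite fimfunE -fsumEFin//.
rewrite ge0_integral_fsum//; last 2 first.
  - move=> r; apply/measurable_EFinP; apply: measurable_funM => //.
    exact: (measurableT_comp (measurable_indic _)).
  - by move=> r z _; rewrite EFinM nnfun_muleindic_ge0.
under [in RHS]eq_integral.
  move=> y _.
  under eq_integral.
    by move=> z _; rewrite fimfunE -fsumEFin//; over.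
  rewrite /= ge0_integral_fsum//; last 2 first.
    - by move=> r; exact/measurable_EFinP/measurableT_comp.
    - by move=> r z _; rewrite EFinM nnfun_muleindic_ge0.
  under eq_fsbigr.
    move=> r _.
    rewrite (integralZl_indic _ (fun r => f @^-1` [set r]))//; last first.
      by move=> r0; rewrite preimage_nnfun0.
    rewrite integral_indic// setIT.
    over.
  over.
rewrite /= ge0_integral_fsum//; last 2 first.
  - by move=> r; apply: measurable_funeM; exact: mkA.
  - move=> n y _.
    have := mulemu_ge0 (fun n => f @^-1` [set n]).
    by apply; exact: preimage_nnfun0.
apply: eq_fsbigr => r _.
have [r0|r0] := leP 0%R r.
  rewrite ge0_integralZl//; last exact: mkA.
  rewrite -disint//.
  under eq_integral do rewrite EFinM.
  rewrite ge0_integralZl//; last first.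
    by apply/measurable_EFinP; exact: (measurableT_comp (measurable_indic _)).
  congr (_ * _).
  rewrite (eq_integral (fun w => (\1_(phi @^-1` (f @^-1` [set r])) w)%:E))//.
  rewrite integral_indic ?(setIC A)//; exact: mpre.
rewrite !integral0_eq// => w _.
  by rewrite preimage_nnfun0// measure0 mule0.
by rewrite preimage_nnfun0// indic0 mulr0.
Qed.

Lemma ge0_integral_disintegration (f : T2 -> \bar R) :
  (forall z, 0 <= f z) -> measurable_fun setT f ->
  \int[m]_(w in A) f (phi w) = \int[m]_(w in A) \int[k w]_z f z.
Proof.
move=> f0 mf; pose f_ := nnsfun_approx measurableT mf.
have lf_ z : (fun n => (f_ n z)%:E) @ \oo --> f z.
  exact: cvg_nnsfun_approx.
have nd_ z a b : (a <= b)%N -> (f_ a z)%:E <= (f_ b z)%:E.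
  by move=> ab; rewrite lee_fin; exact/lefP/nd_nnsfun_approx.
transitivity (\int[m]_(w in A) (lim ((f_ n (phi w))%:E @[n --> \oo]))).
  by apply/eq_integral => z _; apply/esym/cvg_lim => //=; exact: lf_.
rewrite monotone_convergence//; last 3 first.
  - move=> n; apply/measurable_EFinP; exact: (measurableT_comp).
  - by move=> n z _; rewrite lee_fin.
  - by move=> z _ a b ab; exact: nd_.
rewrite (_ : (fun _ => _) =
    (fun n => \int[m]_(w in A) (\int[k w]_z (f_ n z)%:E)))//; last first.
  by apply/funext => n; rewrite disint_nnsfun.
transitivity (\int[m]_(w in A) lim ((\int[k w]_z (f_ n z)%:E) @[n --> \oo])).
  rewrite -monotone_convergence//.
  - move=> n; apply: (@measurable_funS _ _ _ _ setT) => //.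
    apply: (measurable_fun_integral_kernel mk) => //.
    + by move=> z; rewrite lee_fin.
    + exact/measurable_EFinP.
  - by move=> n y _; apply: integral_ge0 => // z _; rewrite lee_fin.
  - move=> y _ a b ab; apply: ge0_le_integral => //.
    + by move=> z _; rewrite lee_fin.
    + exact/measurable_EFinP.
    + exact/measurable_EFinP.
    + by move=> z _; exact: nd_.
apply: eq_integral => y _; rewrite -monotone_convergence//; last 3 first.
  - by move=> n; exact/measurable_EFinP.
  - by move=> n z _; rewrite lee_fin.
  - by move=> z _ a b ab; exact: nd_.
by apply: eq_integral => z _; apply/cvg_lim => //; exact: lf_.
Qed.

End disintegration.

Section exhaustion.
Context d (T : measurableType d) (R : realType).
Variable mu : {sigma_finite_measure set T -> \bar R}.

(** A class of measurable sets closed under countable unions has an element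
    that contains every other one up to a null set. *)
Lemma exhaustion (C : set (set T)) : C !=set0 ->
  (forall S, C S -> measurable S) ->
  (forall S : (set T)^nat, (forall n, C (S n)) -> C (\bigcup_n S n)) ->
  exists2 S, C S & forall S', C S' -> mu (S' `\` S) = 0.
Proof.
move=> [S0 CS0] mC UC.
have CU S S' : C S -> C S' -> C (S `|` S').
  move=> CS CS'.
  rewrite (_ : _ `|` _ = \bigcup_n (fun n => if n is 0%N then S else S') n).
    by apply: UC; case.
  apply/seteqP; split=> [x [Sx|Sx]|x [[|n] _ ?]]; by
    [exists 0%N|exists 1%N|left|right].
have [F TF mF] := sigma_finiteT mu.
have mFn n := (mF n).1.
(* For each piece F n of finite measure, the supremum of the measures of the
   traces on F n is attained by a countable union. *)
pose s n := ereal_sup [set mu (S `&` F n) | S in C].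
have sub1 S n : C S -> mu (S `&` F n) <= s n.
  by move=> CS; apply: ereal_sup_ubound; exists S.
have s_fin n : s n \is a fin_num.
  rewrite ge0_fin_numE; last exact: le_trans (sub1 _ n CS0).
  apply: le_lt_trans (mF n).2; apply: ge_ereal_sup => _ [S CS <-].
  by apply: le_measure; rewrite ?inE//; apply: measurableI => //; exact: mC.
have approx n j : exists S, C S /\ s n - (j.+1%:R^-1)%:E < mu (S `&` F n).
  have : s n - (j.+1%:R^-1)%:E < s n.
    by rewrite lteBlDr ?lteDl// lte_fin invr_gt0.
  move=> /(ereal_sup_gt) [_ [S CS <-] h]; by exists S.
pose Sa n j := proj1_sig (cid (approx n j)).
have Sa1 n j : C (Sa n j) by exact: (proj2_sig (cid (approx n j))).1.
have Sa2 n j : s n - (j.+1%:R^-1)%:E < mu (Sa n j `&` F n).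
  exact: (proj2_sig (cid (approx n j))).2.
pose S := \bigcup_n \bigcup_j Sa n j.
have CS : C S by apply: (UC) => n; apply: (UC) => j.
have mS := mC _ CS.
have attained n : s n <= mu (S `&` F n).
  apply/lee_addgt0Pr => e e0.
  have [j _ /(_ j (leqnn _)) je] :
      \forall j \near \oo, (j.+1%:R^-1 < e :> R)%R.
    exact: near_infty_natSinv_lt (PosNum e0).
  have := ltW (Sa2 n j); rewrite leeBlDr// => /le_trans; apply; apply: leeD.
    apply: le_measure; rewrite ?inE; [apply: measurableI => //; exact: mC|
      exact: measurableI|].
    by apply: setSI => x ?; exists n => //; exists j.
  by rewrite lee_fin ltW.
exists S => // S' CS'.
have mS' := mC _ CS'.
have mD : measurable (S' `\` S) by exact: measurableD.
have n0 n : mu ((S' `\` S) `&` F n) = 0.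
  have mSF : measurable (S `&` F n) by exact: measurableI.
  have mDF : measurable ((S' `\` S) `&` F n) by exact: measurableI.
  have /sub1-/(_ n) := CU _ _ CS CS'.
  have -> : (S `|` S') `&` F n = (S `&` F n) `|` ((S' `\` S) `&` F n).
    rewrite -setIUl; congr (_ `&` _); apply/seteqP; split=> x.
      by have [Sx _|nSx [//|S'x]] := pselect (S x); [left|right].
    by move=> [Sx|[S'x _]]; [left|right].
  rewrite measureU//; last first.
    by apply/seteqP; split => x // [[Sx _] [[_ ?] _]].
  move=> /le_trans /(_ (attained n)).
  have f1 : mu (S `&` F n) \is a fin_num.
    rewrite ge0_fin_numE//; apply: le_lt_trans (sub1 _ n CS) _.
    by rewrite -ge0_fin_numE// (le_trans _ (sub1 _ n CS0)).
  rewrite -[leRHS]adde0 leeD2lE// => le0.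
  by apply/eqP; rewrite eq_le le0 measure_ge0.
apply/(negligibleP _ mD).
rewrite -(setIT (S' `\` S)) TF setI_bigcupr; apply: negligible_bigcup => n.
by apply/negligibleP; [exact: measurableI|exact: n0].
Qed.

End exhaustion.

Lemma measurable_forall d (T : measurableType d) (A : nat -> set T) :
  (forall t, measurable (A t)) -> measurable [set w | forall t, A t w].
Proof.
move=> mA; rewrite (_ : mkset _ = \bigcap_t A t).
  exact: bigcapT_measurable.
by apply/seteqP; split=> w Aw t; [move=> _; exact: Aw|exact: Aw].
Qed.

Lemma measurable_exists d (T : measurableType d) (I : countType)
    (A : I -> set T) :
  (forall i, measurable (A i)) -> measurable [set w | exists i, A i w].
Proof.
move=> mA; rewrite (_ : mkset _ = \bigcup_n (if unpickle n is Some i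
    then A i else set0)).
  by apply: bigcupT_measurable => n; case: unpickle.
apply/seteqP; split=> [w [i Ai]|w [n _]].
  by exists (pickle i) => //; rewrite pickleK.
by case: unpickle => // i; exists i.
Qed.

Lemma measurable_fun_cases d1 d2 (T1 : measurableType d1)
    (T2 : measurableType d2) (I : countType) (c : T1 -> I) (f : I -> T1 -> T2) :
  (forall i, measurable [set w | c w = i]) ->
  (forall i, measurable_fun setT (f i)) ->
  measurable_fun setT (fun w => f (c w) w).
Proof.
move=> mc mf _ B mB; rewrite setTI.
rewrite (_ : _ @^-1` B =
    [set w | exists i, ([set w | c w = i] `&` f i @^-1` B) w]).
  apply: measurable_exists => i; apply: measurableI => //.
  by rewrite -[X in measurable X]setTI; exact: mf.
apply/seteqP; split=> w /=; first by exists (c w).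
by move=> [_ [<-]].
Qed.

Lemma measurable_imp d (T : measurableType d) (q : Prop) (A : set T) :
  (q -> measurable A) -> measurable [set w | q -> A w].
Proof.
move=> mA; have [qT|qF] := pselect q.
  rewrite (_ : mkset _ = A); first exact: mA.
  by apply/seteqP; split=> w /=; [exact|].
by rewrite (_ : mkset _ = setT)//; apply/seteqP; split=> // w _ /qF.
Qed.

Lemma measurable_and d (T : measurableType d) (q : Prop) (A : set T) :
  (q -> measurable A) -> measurable [set w | q /\ A w].
Proof.
move=> mA; have [qT|qF] := pselect q.
  rewrite (_ : mkset _ = A); first exact: mA.
  by apply/seteqP; split=> w /=; [case|].
by rewrite (_ : mkset _ = set0)//; apply/seteqP; split=> w // [].
Qed.

Lemma negligible_exists d (T : measurableType d) (R : realType)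
    (m : {measure set T -> \bar R}) (I : countType) (N : I -> set T) :
  (forall i, m.-negligible (N i)) -> m.-negligible [set w | exists i, N i w].
Proof.
move=> N0; apply: (@negligibleS _ _ _ _
    (\bigcup_n (if unpickle n is Some i then N i else set0))).
  by move=> w [i Ni]; exists (pickle i) => //; rewrite pickleK.
apply: negligible_bigcup => n; case: unpickle => //.
exact: negligible_set0.
Qed.

(** * Histories, the shift and the Markov property *)

Section path_measurability.
Context {X : ptopologicalType}.

(** The path space with the information available at time [t]; its measurable
    sets are the events of [history t]. *)
Definition observed_paths (t : nat) :=
  g_sigma_algebraType (\bigcup_(s in [set s | (s <= t)%N])
                         @coordinate_events X s).

Lemma measurable_observed_coordinate s t : (s <= t)%N ->
  measurable_fun setT (fun w : observed_paths t => w s : borel X).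
Proof.
move=> st _ B mB; apply: sub_sigma_algebra; exists s => //; by exists B.
Qed.

Lemma measurable_coordinate t :
  measurable_fun setT (fun w : path_space X => w t : borel X).
Proof.
move=> _ B mB; apply: sub_sigma_algebra; exists t => //; by exists B.
Qed.

Lemma history_measurable t (A : set (path_space X)) :
  history t A -> measurable A.
Proof.
apply: sub_sigma_algebra2 => B [s _ sB]; by exists s.
Qed.

Lemma history_le s t (A : set (path_space X)) : (s <= t)%N ->
  history s A -> history t A.
Proof.
move=> st; apply: sub_sigma_algebra2 => B [r rs rB]; exists r => //=.
exact: leq_trans st.
Qed.

Lemma history_coordinate s t (B : set (borel X)) : (s <= t)%N ->
  measurable B -> history t [set w | B (w s)].
Proof.
move=> st mB; rewrite -[X in history _ X]setTI.
exact: (@measurable_observed_coordinate s t st measurableT _ mB).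
Qed.

Lemma measurable_at t (B : set (borel X)) : measurable B ->
  measurable [set w : path_space X | B (w t)].
Proof. by move=> mB; exact: history_measurable (history_coordinate (leqnn t) mB). Qed.

Lemma measurable_shift n : measurable_fun setT (@Defs.shift X n).
Proof.
apply: (@measurability _ _ (path_space X) (path_space X) setT (@Defs.shift X n) (@cylinders X)) => // _ [_ [t _ [B mB <-]] <-].
rewrite !setTI; apply: (@measurable_at (n + t)%N B mB).
Qed.

Lemma history_measurable_fun {R : realType} t (f : path_space X -> R) :
  (forall B : set R, measurable B -> history t (f @^-1` B)) ->
  measurable_fun setT f.
Proof. by move=> hf _ B mB; rewrite setTI; exact: history_measurable (hf B mB). Qed.

End path_measurability.

Section markov.
Context {R : realType} {X : ptopologicalType}.
Variable P : R.-pker (borel X) ~> (path_space X).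
Hypothesis markovP : strong_markov P.

(** The Markov property at a constant time, for functions of the future. *)
Lemma markov_integral x n (A : set (path_space X))
    (f : path_space X -> \bar R) :
  history n A -> (forall w, 0 <= f w) -> measurable_fun setT f ->
  \int[P x]_(w in A) f (Defs.shift n w) =
  \int[P x]_(w in A) \int[P (w n)]_v f v.
Proof.
move=> hA f0 mf; have mA := history_measurable hA.
apply: (@ge0_integral_disintegration _ _ _ _ _ _ _ mA _
  (fun w => P (w n) : {measure set (path_space X) -> \bar R})) => //.
- exact: measurable_shift.
- move=> B mB; apply: (measurableT_comp (measurable_kernel P _ mB)).
  exact: measurable_coordinate.
move=> B mB; have [_ /(_ x (fun=> Some n)) sm] := markovP.
have hb t : happens_by (X := X) (fun=> Some n) t =
    if (n <= t)%N then setT else set0.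
  apply/seteqP; split=> w; first by move=> [_ [<-] ->].
  by case: ifPn => // nt _; exists n.
have st : stopping_time (X := X) (fun=> Some n).
  by move=> t; rewrite hb; case: ifPn => _;
    [exact: (@measurableT _ (observed_paths t))|
     exact: (@measurable0 _ (observed_paths t))].
have sA : stopped_history (X := X) (fun=> Some n) A.
  split=> // t; rewrite hb; case: ifPn => nt; rewrite ?setIT ?setI0.
    exact: history_le hA.
  exact: (@measurable0 _ (observed_paths t)).
have := sm st _ _ sA mB.
rewrite (_ : [set w | _ w != None] = setT) ?setIT; last by apply/seteqP; split.
move=> <-; congr (P x (_ `&` _)); apply/seteqP; split=> w /=.
  by move=> Bw; exists n.
by move=> [_ [<-]].
Qed.

End markov.

(** * Payoffs collected at a first visit *)

Section first_time.
Implicit Type b : set nat.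

(** The least positive element of a set of times; visits at time 0 do not
    count. *)
Definition first_time b : option nat :=
  match pselect (exists t, (0 < t)%N && (t \in b)) with
  | left ex => Some (ex_minn ex)
  | right _ => None
  end.

Variant first_time_spec b : option nat -> Prop :=
| FirstTime t of (0 < t)%N & b t & (forall s, (0 < s < t)%N -> ~ b s) :
    first_time_spec b (Some t)
| NoTime of (forall t, (0 < t)%N -> ~ b t) : first_time_spec b None.

Lemma first_timeP b : first_time_spec b (first_time b).
Proof.
rewrite /first_time; case: pselect => [ex|nex].
  case: ex_minnP => t /andP[t0 /set_mem bt] tmin; apply: FirstTime => //.
  move=> s /andP[s0 st] bs; have := tmin s; rewrite s0 mem_set//= => /(_ isT).
  by rewrite leqNgt st.
by apply: NoTime => t t0 bt; apply: nex; exists t; rewrite t0 mem_set.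
Qed.

Lemma first_timeE b t : (0 < t)%N -> b t ->
  (forall s, (0 < s < t)%N -> ~ b s) -> first_time b = Some t.
Proof.
move=> t0 bt tmin; case: first_timeP => [s s0 bs smin|/(_ t t0)//].
have [st|ts|->//] := ltngtP s t.
  by have := tmin s; rewrite s0 st => /(_ isT).
by have := smin t; rewrite t0 ts => /(_ isT).
Qed.

Lemma first_timeN b : (forall t, (0 < t)%N -> ~ b t) -> first_time b = None.
Proof. by move=> nb; case: first_timeP => // t t0 /(nb _ t0). Qed.

Lemma eq_first_time b b' : (forall t, (0 < t)%N -> b t <-> b' t) ->
  first_time b = first_time b'.
Proof.
move=> bb'; case: first_timeP => [t t0 bt tmin|nb].
  rewrite (@first_timeE b' t)//; first exact/bb'.
  by move=> s /andP[s0 st] /(bb' _ s0); apply: tmin; rewrite s0.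
by rewrite first_timeN// => t t0 /(bb' _ t0); exact: nb.
Qed.

Lemma eq_first_time_upto b b' t : (0 < t)%N -> b t ->
  (forall s, (0 < s <= t)%N -> b s <-> b' s) -> first_time b = first_time b'.
Proof.
move=> t0 bt bb'; case: first_timeP => [s s0 bs smin|/(_ t t0)//].
have st : (s <= t)%N.
  by rewrite leqNgt; apply/negP => ts; apply: (smin t) => //; rewrite t0.
rewrite (@first_timeE b' s)//; first by apply/bb'; rewrite ?s0.
move=> r /andP[r0 rs] /bb' br; apply: (smin r); first by rewrite r0.
by apply: br; rewrite r0 (leq_trans (ltnW rs)).
Qed.

End first_time.

Lemma measurable_first_time d (T : measurableType d) (b : T -> set nat) :
  (forall t, measurable [set w | b w t]) ->
  forall o, measurable [set w | first_time (b w) = o].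
Proof.
move=> mb [t|].
  rewrite (_ : mkset _ = [set w | (0 < t)%N /\ b w t] `&`
    [set w | forall s, (0 < s < t)%N -> (~` [set w | b w s]) w]).
    apply: measurableI; first exact: (@measurable_and _ _ (0 < t)%N _ (fun=> mb t)).
    apply: measurable_forall => s; apply: measurable_imp => _.
    exact: measurableC.
  apply/seteqP; split=> w /=.
    by case: first_timeP => // s s0 bs smin [<-].
  by move=> [[t0 bt] tmin]; exact: first_timeE.
rewrite (_ : mkset _ =
    [set w | forall s, (0 < s)%N -> (~` [set w | b w s]) w]).
  apply: measurable_forall => s; apply: measurable_imp => _; exact: measurableC.
apply/seteqP; split=> w /=; first by case: first_timeP.
exact: first_timeN.
Qed.

Section stop_pay.
Context {R : realType} {X : ptopologicalType}.
Local Notation Omega := (path_space X).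
Variable a : payoff R (borel X).
Hypothesis disc : discount_function (discount a).
Hypothesis a0 : forall x,
  [/\ (0 <= lead a x)%R, (0 <= follow a x)%R & (0 <= both a x)%R].
Hypothesis ma : [/\ measurable_fun setT (lead a), measurable_fun setT (follow a)
                  & measurable_fun setT (both a)].
Implicit Types (k : borel X -> R) (b : set nat) (w : Omega).

(** The payoff on paths where nobody ever stops. *)
Definition never_pay w : \bar R :=
  limn_esup (fun t => (discount a t * both a (w t))%:E).

(** The payoff from stopping at the first positive time in [b] with reward
    [k]. *)
Definition stop_pay k b w : \bar R :=
  if first_time b is Some t then (discount a t * k (w t))%:E else never_pay w.

(** The integrable bound on all payoffs collected at positive times. *)
Definition envelope w : \bar R :=
  ereal_sup [set (discount a t *
                  (lead a (w t) + follow a (w t) + both a (w t)))%:E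
            | t in [set t | (1 <= t)%N]].

Let d0 t : (0 <= discount a t)%R.
Proof. by have [/(_ t)/andP[]] := disc. Qed.

Lemma discount_gt0 t : (0 < discount a t)%R.
Proof.
have [_ /(_ t t.+1 (leqnn _)) lt _ _] := disc.
exact: le_lt_trans lt.
Qed.

Lemma stop_payE k b w t : (0 < t)%N -> b t ->
  (forall s, (0 < s < t)%N -> ~ b s) ->
  stop_pay k b w = (discount a t * k (w t))%:E.
Proof. by move=> t0 bt tmin; rewrite /stop_pay (first_timeE t0 bt tmin). Qed.

Lemma stop_payN k b w : (forall t, (0 < t)%N -> ~ b t) ->
  stop_pay k b w = never_pay w.
Proof. by move=> nb; rewrite /stop_pay first_timeN. Qed.

Lemma eq_stop_pay k b b' w : (forall t, (0 < t)%N -> b t <-> b' t) ->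
  stop_pay k b w = stop_pay k b' w.
Proof. by move=> bb'; rewrite /stop_pay (eq_first_time bb'). Qed.

Lemma never_pay_le n w : never_pay w <=
  esups (fun t => (discount a t * both a (w t))%:E) n.
Proof. exact: limn_esup_le_esups. Qed.

Lemma never_pay_ge0 w : 0 <= never_pay w.
Proof.
apply: le_limn_esup_lb => n; apply: le_trans (esups_ub _ (leqnn n)).
by rewrite lee_fin mulr_ge0//; have [] := a0 (w n).
Qed.

Lemma stop_pay_ge0 k b w : (forall x, (0 <= k x)%R) -> 0 <= stop_pay k b w.
Proof.
move=> k0; rewrite /stop_pay; case: first_time => [t|].
  by rewrite lee_fin mulr_ge0.
exact: never_pay_ge0.
Qed.

Lemma le_envelope w t r : (0 < t)%N ->
  (r <= lead a (w t) + follow a (w t) + both a (w t))%R ->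
  (discount a t * r)%:E <= envelope w.
Proof.
move=> t0 rle; apply: le_trans; last by apply: ereal_sup_ubound; exists t.
by rewrite lee_fin ler_wpM2l.
Qed.

Lemma stop_pay_le k b w :
  (forall x, (k x <= lead a x + follow a x + both a x)%R) ->
  stop_pay k b w <= envelope w.
Proof.
move=> kle; rewrite /stop_pay; case: first_timeP => [t t0 _ _|_].
  exact: le_envelope.
apply: le_trans (never_pay_le 1 w) _; apply: esups_le => t t0.
apply: le_envelope => //; rewrite lerDr addr_ge0//; by have [] := a0 (w t).
Qed.

Lemma measurable_reward k t : measurable_fun setT k ->
  measurable_fun setT (fun w : Omega => (discount a t * k (w t))%:E).
Proof.
move=> mk; apply/measurable_EFinP; apply: measurable_funM => //.
exact: (measurableT_comp mk (measurable_coordinate t)).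
Qed.

Lemma measurable_never_pay : measurable_fun setT never_pay.
Proof.
apply: (measurable_fun_limn_esup
  (f := fun t w => (discount a t * both a (w t))%:E)) => t.
by apply: measurable_reward; case: ma.
Qed.

Lemma measurable_envelope : measurable_fun setT envelope.
Proof.
apply: (measurable_fun_esups (f := fun t w => (discount a t *
  (lead a (w t) + follow a (w t) + both a (w t)))%:E)) => t.
apply: (measurable_reward (k := fun x => (lead a x + follow a x + both a x)%R)).
by case: ma => mf mg mh; do 2 apply: measurable_funD => //.
Qed.

Lemma measurable_stop_pay k (b : Omega -> set nat) : measurable_fun setT k ->
  (forall t, measurable [set w | b w t]) ->
  measurable_fun setT (fun w => stop_pay k (b w) w).
Proof.
move=> mk mb; pose f o w := if o is Some t then (discount a t * k (w t))%:E
  else never_pay w.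
apply: (measurable_fun_cases (c := fun w => first_time (b w)) (f := f)).
  exact: measurable_first_time.
by move=> [t|]; [exact: measurable_reward|exact: measurable_never_pay].
Qed.

(** Restarting the clock at time [n] undervalues later payoffs, since
    [discount a n * discount a t <= discount a (n + t)]. *)
Lemma stop_pay_shift k b b' n w : (forall x, (0 <= k x)%R) ->
  (forall t, (0 < t <= n)%N -> ~ b' t) ->
  (forall t, (0 < t)%N -> b' (n + t)%N <-> b t) ->
  (discount a n)%:E * stop_pay k b (Defs.shift n w) <= stop_pay k b' w.
Proof.
move=> k0 b'n bb'; have [_ _ _ dd] := disc.
rewrite {1}/stop_pay; case: first_timeP => [t t0 bt tmin|nb].
  rewrite (@stop_payE _ _ _ (n + t)%N); last 3 first.
  - by rewrite addn_gt0 t0 orbT.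
  - exact/bb'.
  - move=> s /andP[s0 st]; have [sn|ns] := leqP s n.
      by apply: b'n; rewrite s0.
    rewrite -(subnKC (ltnW ns)) bb' ?subn_gt0//; apply: tmin.
    by rewrite subn_gt0 ns ltn_subLR// ltnW.
  by rewrite -EFinM lee_fin mulrA ler_wpM2r.
rewrite stop_payN; last first.
  move=> t t0; have [tn|nt] := leqP t n; first by apply: b'n; rewrite t0.
  by rewrite -(subnKC (ltnW nt)) bb' ?subn_gt0//; apply: nb; rewrite subn_gt0.
apply: le_limn_esup_lb => m.
rewrite -lee_pdivlMl ?discount_gt0//.
apply: le_trans (limn_esup_le_esups _ m) _; apply: esups_le => t mt.
rewrite lee_pdivlMl ?discount_gt0//.
apply: (@le_trans _ _ ((discount a (n + t) * both a (w (n + t)%N))%:E)).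
  rewrite -EFinM lee_fin mulrA ler_wpM2r//.
  by have [] := a0 (w (n + t)%N).
by apply: (esups_ub (fun t => (discount a t * both a (w t))%:E));
  rewrite (leq_trans mt)// leq_addl.
Qed.

End stop_pay.

Section start.
Context {R : realType} {X : ptopologicalType}.
Hypothesis polX : polish R X.

Lemma polish_measurable1 (x : borel X) : measurable [set x].
Proof.
have [_ [d [[d0 deq] _ nb _]]] := polX.
rewrite -[X in measurable X]setCK; apply: measurableC.
apply: sub_sigma_algebra; rewrite openE => y /= yx.
apply/nb; exists (d y x).
  by rewrite lt_neqAle d0 andbT eq_sym; apply/eqP => /deq.
by move=> z /= zy zx; rewrite zx ltxx in zy.
Qed.

Variable P : R.-pker (borel X) ~> (path_space X).
Hypothesis markovP : strong_markov P.

Lemma ae_start x : {ae P x, forall w, w 0%N = x}.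
Proof.
have mx : measurable [set w : path_space X | w 0%N = x].
  exact: (@measurable_at X 0%N [set x] (polish_measurable1 x)).
exists (~` [set w | w 0%N = x]); split => //; first exact: measurableC.
have := @prob_kernel _ _ _ _ _ P x.
rewrite -(setUv [set w : path_space X | w 0%N = x]) measureU ?setICr//; last first.
  exact: measurableC.
move=> P1; have {}P1 : 1 + P x (~` [set w | w 0%N = x]) = 1.
  by rewrite -{2}P1; congr (_ + _); exact/esym/(markovP.1 x).
move: P1; case: (P x _) => [r||]// [r1]; congr EFin.
by apply: (@addrI _ 1%R); rewrite addr0.
Qed.

End start.

Section value.
Context {R : realType} {X : ptopologicalType}.
Variables (P : R.-pker (borel X) ~> (path_space X)) (a : payoff R (borel X)).
Implicit Types (S T : set (borel X)) (w : path_space X).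

(** The reward at the moment when either player stops, the opponent stopping on
    [T]. A simultaneous stop pays [follow]: at an equilibrium, [both] and
    [follow] agree wherever both players stop. *)
Definition reward T (x : borel X) : R := if x \in T then follow a x else lead a x.

(** The continuation value: the player's expected payoff when stopping at the
    first positive time spent in [S], the opponent stopping at the first
    positive time spent in [T]. *)
Definition value T S x : \bar R :=
  \int[P x]_w stop_pay a (reward T) [set t | (S `|` T) (w t)] w.

Hypothesis a0 : forall x,
  [/\ (0 <= lead a x)%R, (0 <= follow a x)%R & (0 <= both a x)%R].
Hypothesis ma : [/\ measurable_fun setT (lead a), measurable_fun setT (follow a)
                  & measurable_fun setT (both a)].
Hypothesis disc : discount_function (discount a).

Lemma reward_ge0 T x : (0 <= reward T x)%R.
Proof. by rewrite /reward; have [] := a0 x; case: ifP. Qed.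

Lemma reward_le T x :
  (reward T x <= lead a x + follow a x + both a x)%R.
Proof.
rewrite /reward; have [f0 g0 h0] := a0 x; case: ifP => _.
  by rewrite -addrA addrC -addrA lerDl addr_ge0.
by rewrite -addrA lerDl addr_ge0.
Qed.

Lemma measurable_reward_fun T : measurable T -> measurable_fun setT (reward T).
Proof.
move=> mT; case: ma => mf mg _; apply: measurable_fun_ifT => //.
by apply: (measurable_fun_bool true); rewrite setTI preimage_mem_true.
Qed.

Lemma measurable_visits_pay T S : measurable T -> measurable S ->
  measurable_fun setT (fun w : path_space X =>
    stop_pay a (reward T) [set t | (S `|` T) (w t)] w).
Proof.
move=> mT mS; apply: (measurable_stop_pay (b := fun w : path_space X => [set t | (S `|` T) (w t)]) ma).
  exact: measurable_reward_fun.
by move=> t; apply: measurable_at; exact: measurableU.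
Qed.

Lemma measurable_value T S : measurable T -> measurable S ->
  measurable_fun setT (value T S).
Proof.
move=> mT mS; apply: (measurable_fun_integral_kernel (measurable_kernel P)).
  by move=> w; apply: stop_pay_ge0 => // x; exact: reward_ge0.
exact: measurable_visits_pay.
Qed.

End value.

(** * Improving a policy by stopping less often *)

(** A player heads for [S m]; whenever the current target is reached outside
    [Q] and [T], some [S n] makes going on profitable, and becomes the new
    target. Since [Q] lies in all targets, iterating amounts to stopping
    on [Q]. *)
Section improvement.
Context {R : realType} {X : ptopologicalType}.
Hypothesis polX : polish R X.
Variables (P : R.-pker (borel X) ~> (path_space X)) (a : payoff R (borel X)).
Hypothesis markovP : strong_markov P.
Hypothesis adm : admissible P a.
Hypothesis ord : forall x, (lead a x <= both a x <= follow a x)%R.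
Implicit Types (w : path_space X).

Let disc : discount_function (discount a). Proof. by case: adm. Qed.
Let a0 x : [/\ (0 <= lead a x)%R, (0 <= follow a x)%R & (0 <= both a x)%R].
Proof. by case: adm. Qed.
Let ma : [/\ measurable_fun setT (lead a), measurable_fun setT (follow a)
           & measurable_fun setT (both a)].
Proof. by case: adm. Qed.
Let afin x : \int[P x]_w envelope a w < +oo. Proof. by case: adm. Qed.

Variables (T Q : set (borel X)) (S : nat -> set (borel X)) (m : nat).
Hypotheses (mT : measurable T) (mQ : measurable Q).
Hypotheses (mS : forall n, measurable (S n)) (QS : forall n, Q `<=` S n).
Hypothesis goon : forall y, ~ (Q `|` T) y ->
  exists n, (lead a y)%:E <= value P a T (S n) y.

Let B n := S n `|` T.
Let D := Q `|` T.

Let mB n : measurable (B n). Proof. exact: measurableU. Qed.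
Let mD : measurable D. Proof. exact: measurableU. Qed.
Let DB n y : D y -> B n y.
Proof. by move=> [/QS Sy|Ty]; [left|right]. Qed.

(* The least index of a set that it is profitable to aim at from [y]. *)
Let next y : nat :=
  match pselect (exists n, (lead a y)%:E <= value P a T (S n) y) with
  | left ex => ex_minn ex
  | right _ => 0
  end.

Let next_le y : ~ D y -> (lead a y)%:E <= value P a T (S (next y)) y.
Proof.
by move=> /goon ex; rewrite /next; case: pselect => // ex'; case: ex_minnP.
Qed.

Let measurable_next j : measurable [set y | next y = j].
Proof.
pose G n := [set y : borel X | (lead a y)%:E <= value P a T (S n) y].
have mG n : measurable (G n).
  rewrite -[X in measurable X]setTI; apply: measurable_lee => //.
    by apply/measurable_EFinP; case: ma.
  exact: measurable_value.
rewrite (_ : mkset _ =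
   (G j `&` [set y | forall i, (i < j)%N -> (~` G i) y]) `|`
   [set y | j = 0%N /\ [set y | forall i, (~` G i) y] y]).
  apply: measurableU.
    apply: measurableI => //; apply: measurable_forall => i.
    by apply: measurable_imp => _; exact: measurableC.
  by apply: measurable_and => _; apply: measurable_forall => i; exact: measurableC.
apply/seteqP; split=> y /=.
  rewrite /next; case: pselect => [ex|nex] <-.
    left; case: ex_minnP => k Gk kmin; split=> // i ik Gi.
    by have := kmin i Gi; rewrite leqNgt ik.
  by right; split=> // i Gi; apply: nex; exists i.
rewrite /next; case: pselect => [ex|nex].
  case: ex_minnP => k Gk kmin [[Gj jmin]|[_ /(_ k)//]].
  apply/eqP; rewrite eqn_leq kmin//= leqNgt.
  by apply/negP => /jmin; exact.
by move=> [[Gj _]|[->]//]; exfalso; apply: nex; exists j.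
Qed.

(* The set aimed at after time [t]: it changes at each visit to the current
   one. *)
Let target w := fix target t : nat :=
  if t is s.+1 then
    if w t \in B (target s) then next (w t) else target s
  else m.

Let target_history t j : history t [set w | target w t = j].
Proof.
elim: t j => [|t IH] j.
  rewrite (_ : mkset _ = [set w | m = j /\ setT w]).
    by apply: (@measurable_and _ (@observed_paths X 0)) => _; exact: measurableT.
  by apply/seteqP; split=> w //= [].
rewrite (_ : mkset _ = [set w | exists i, ([set w | target w t = i] `&`
    (([set w | B i (w t.+1)] `&` [set w | next (w t.+1) = j]) `|`
     (~` [set w | B i (w t.+1)] `&` [set w | i = j /\ setT w]))) w]).
  apply: (@measurable_exists _ (@observed_paths X t.+1) nat) => i.
  apply: measurableI; first exact: (history_le (leqnSn t) (IH i)).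
  have mBi : history t.+1 [set w | B i (w t.+1)] by exact: history_coordinate.
  apply: measurableU; apply: measurableI => //.
  - by apply: (@history_coordinate X t.+1 t.+1 [set y | next y = j]).
  - exact: measurableC.
  - by apply: measurable_and => _; exact: measurableT.
apply/seteqP; split=> w /=.
  move=> wj; exists (target w t); split => //; move: wj.
  case: ifPn => [/set_mem Bw <-|/negP nBw <-]; first by left.
  by right; split => // Bw; apply: nBw; exact: mem_set.
move=> [i [-> [[/mem_set -> ->]|[nB [<- _]]]]]; first by [].
by rewrite memNset.
Qed.

(* The strategy that stops changing target at time [n]. *)
Let visits n w : set nat :=
  [set t | if (t <= n)%N then D (w t) else B (target w n) (w t)].

Let Y n w := stop_pay a (reward a T) (visits n w) w.

Let Y0 n w : 0 <= Y n w.
Proof. by apply: stop_pay_ge0 => // x; exact: reward_ge0. Qed.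

Let mY n : measurable_fun setT (Y n).
Proof.
apply: (measurable_stop_pay (b := visits n) ma); first exact: measurable_reward_fun.
move=> t; rewrite /visits /=; case: (t <= n)%N; first exact: measurable_at.
rewrite (_ : mkset _ = [set w | exists j,
    ([set w | target w n = j] `&` [set w | B j (w t)]) w]).
  apply: measurable_exists => j; apply: measurableI; last exact: measurable_at.
  exact: history_measurable (@target_history n j).
apply/seteqP; split=> w /=; first by exists (target w n).
by move=> [_ [<-]].
Qed.

(* The event on which the strategies of levels [n] and [n.+1] differ. *)
Let E n : set (path_space X) := [set w | (forall t, (0 < t <= n.+1)%N -> ~ D (w t)) /\
                    B (target w n) (w n.+1)].

Let historyE n : history n.+1 (E n).
Proof.
rewrite (_ : E n =
   [set w | forall t, (0 < t <= n.+1)%N -> (~` [set w | D (w t)]) w] `&`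
   [set w | exists j, ([set w | target w n = j] `&`
                       [set w | B j (w n.+1)]) w]).
  apply: (@measurableI _ (@observed_paths X n.+1)).
    apply: (@measurable_forall _ (@observed_paths X n.+1)) => t.
    apply: (@measurable_imp _ (@observed_paths X n.+1)) => /andP[_ tn].
    by apply: measurableC; exact: history_coordinate.
  apply: (@measurable_exists _ (@observed_paths X n.+1) nat) => j.
  apply: measurableI; last exact: history_coordinate.
  exact: (history_le (leqnSn n) (@target_history n j)).
apply/seteqP; split=> w /= [nD].
  by move=> Bw; split => //; exists (target w n).
by move=> [_ [<-]].
Qed.

Let Y_off n w : ~ E n w -> Y n w = Y n.+1 w.
Proof.
move=> nE; rewrite /Y.
have [[t [/andP[t0 tn] Dt]]|nD] :=
  pselect (exists t, (0 < t <= n.+1)%N /\ D (w t)).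
  rewrite /stop_pay (@eq_first_time_upto _ (visits n.+1 w) t)//.
    by rewrite /visits /=; case: ifP => // _; exact: DB.
  move=> s /andP[s0 st]; rewrite /visits /= (leq_trans st tn).
  case: ifPn => // ns; have es : s = n.+1.
    by apply/eqP; rewrite eqn_leq (leq_trans st tn) ltnNge.
  have ets : t = s by apply/eqP; rewrite eqn_leq st es tn.
  by rewrite -ets; split=> // _; exact: DB.
have nD' t : (0 < t <= n.+1)%N -> ~ D (w t) by move=> ? ?; apply: nD; exists t.
have nB : ~ B (target w n) (w n.+1) by move=> Bw; apply: nE.
have targetE : target w n.+1 = target w n by rewrite /= memNset.
apply: eq_stop_pay => t t0; rewrite /visits /= memNset//.
have [tn|nt] := leqP t n; first by rewrite leqW.
have [tn|//] := leqP t n.+1.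
have -> : t = n.+1 by apply/eqP; rewrite eqn_leq tn.
by split=> // /nD'; rewrite leqnn; case.
Qed.

Let Y_on n w : E n w -> Y n w = (discount a n.+1 * lead a (w n.+1))%:E.
Proof.
move=> [nD Bw]; rewrite /Y (@stop_payE _ _ _ _ _ _ n.+1)//.
- rewrite /reward memNset// => Tw.
  by apply: (nD n.+1); [rewrite leqnn|right].
- by rewrite /visits /= ltnn.
- move=> s /andP[s0 sn]; rewrite /visits /= -ltnS sn.
  by apply: nD; rewrite s0 ltnW.
Qed.

(* The payoff of heading for the target selected at the starting point. *)
Let G w := stop_pay a (reward a T) [set t | B (next (w 0%N)) (w t)] w.

Let mG : measurable_fun setT G.
Proof.
apply: (measurable_stop_pay (b := fun w : path_space X =>
  [set t | B (next (w 0%N)) (w t)]) ma); first exact: measurable_reward_fun.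
move=> t; rewrite (_ : mkset _ = [set w : path_space X | exists j,
    ([set w | next (w 0%N) = j] `&` [set w | B j (w t)]) w]).
  apply: measurable_exists => j; apply: measurableI; last exact: measurable_at.
  exact: (@measurable_at X 0%N [set y | next y = j]).
apply/seteqP; split=> w /=; first by exists (next (w 0%N)).
by move=> [_ [<-]].
Qed.

Let G0 w : 0 <= G w.
Proof. by apply: stop_pay_ge0 => // x; exact: reward_ge0. Qed.

Let int_G y : ~ D y -> (lead a y)%:E <= \int[P y]_w G w.
Proof.
move=> /next_le /le_trans; apply; rewrite le_eqVlt; apply/orP; left; apply/eqP.
apply: (ge0_eq_integral_ae _ _ _ _ (ae_start polX markovP y)) => //.
- exact: measurable_visits_pay.
- by move=> w; apply: stop_pay_ge0 => // x; exact: reward_ge0.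
- by move=> w <-.
Qed.

Let Y_next n w : E n w ->
  (discount a n.+1)%:E * G (Defs.shift n.+1 w) <= Y n.+1 w.
Proof.
move=> [nD Bw]; apply: stop_pay_shift => //.
- by move=> x; exact: reward_ge0.
- move=> t /andP[t0 tn]; rewrite /visits /= tn; apply: nD.
  by rewrite t0.
- move=> t t0; rewrite /visits /= mem_set// leqNgt -[X in (X < _)%N]addn0.
  by rewrite ltn_add2l t0 /= /Defs.shift addn0.
Qed.

Let step x n : \int[P x]_w Y n w <= \int[P x]_w Y n.+1 w.
Proof.
have mE : measurable (E n) by exact: history_measurable (@historyE n).
apply: (le_integral_off mE) => //; first exact: Y_off.
have d0 : (0 <= discount a n.+1)%R by exact/ltW/discount_gt0.
have mGs : measurable_fun setT (fun w => G (Defs.shift n.+1 w)).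
  exact: (measurableT_comp mG (measurable_shift n.+1)).
have mEG : measurable_fun setT
    (fun w : path_space X => \int[P (w n.+1)]_v G v).
  apply: (measurableT_comp (f := fun y => \int[P y]_v G v)).
    exact: (measurable_fun_integral_kernel (measurable_kernel P)).
  exact: measurable_coordinate.
apply: (@le_trans _ _ (\int[P x]_(w in E n)
    ((discount a n.+1)%:E * \int[P (w n.+1)]_v G v))).
  apply: ge0_le_integral => //.
  - exact: measurable_funS (mY n).
  - apply: measurable_funeM; exact: measurable_funS mEG.
  move=> w Ew; rewrite Y_on// EFinM lee_wpmul2l// int_G//.
  by apply: Ew.1; rewrite leqnn.
rewrite ge0_integralZl//; last 2 first.
- exact: measurable_funS mEG.
- by move=> w _; apply: integral_ge0.
rewrite -(markov_integral markovP x (@historyE n) G0 mG).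
rewrite -ge0_integralZl//; last exact: measurable_funS mGs.
apply: ge0_le_integral => //.
- by move=> w _; rewrite mule_ge0.
- apply: measurable_funeM; exact: measurable_funS mGs.
- exact: measurable_funS (mY n.+1).
- exact: Y_next.
Qed.

Let limit w : limn_esup (Y ^~ w) <= stop_pay a (reward a T) [set t | D (w t)] w.
Proof.
rewrite /stop_pay; case: first_timeP => [t t0 Dt tmin|nD].
  apply: le_trans (limn_esup_le_esups _ t) _; apply: esups_le => n tn.
  rewrite /Y (@stop_payE _ _ _ _ _ _ t)//; first by rewrite /visits /= tn.
  move=> s /andP[s0 st]; rewrite /visits /= (leq_trans (ltnW st) tn).
  by apply: tmin; rewrite s0.
apply: le_limn_esup_lb => n.
apply: le_trans (limn_esup_le_esups _ n) _; apply: esups_le => k nk.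
rewrite /Y /stop_pay; case: first_timeP => [t t0 + _|_]; last exact: never_pay_le.
rewrite /visits /=; case: leqP => [_ /nD|kt _]; first by move/(_ t0).
have -> : reward a T (w t) = lead a (w t).
  by rewrite /reward memNset// => Tw; apply: (nD t t0); right.
apply: (@le_trans _ _ ((discount a t * both a (w t))%:E)).
  rewrite lee_fin ler_wpM2l//; last by case/andP: (ord (w t)).
  exact/ltW/discount_gt0.
apply: (esups_ub (fun t => (discount a t * both a (w t))%:E)).
exact: leq_trans nk (ltnW kt).
Qed.

(** On a path that never meets [Q] or [T], the intermediate payoffs are later
    and later values of [lead], or the payoff of never stopping; by
    [lead <= both], the latter bounds their limit superior. *)
Lemma value_improvement x : value P a T (S m) x <= value P a T Q x.
Proof.
have EY0 : value P a T (S m) x = \int[P x]_w Y 0 w.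
  apply: eq_integral => w _; apply: eq_stop_pay => t t0.
  by rewrite /visits /= leqNgt t0.
apply: (@le_trans _ _ (\int[P x]_w limn_esup (Y ^~ w))).
  apply: (reverse_fatou (Z := envelope a)) => //.
  - exact: measurable_envelope.
  - by move=> n w; apply: stop_pay_le => // y; exact: reward_le.
  - by elim => [|n IH]; [rewrite EY0|exact: le_trans IH (step x n)].
apply: ge0_le_integral => //.
- move=> w _; apply: le_limn_esup_lb => n.
  exact: le_trans (Y0 n w) (esups_ub _ (leqnn n)).
- exact: measurable_fun_limn_esup.
- exact: measurable_visits_pay.
Qed.

End improvement.

(** * Nonnegative supermartingales converge almost surely *)

Section supermartingale_integral.
Context {R : realType} {X : ptopologicalType}.
Variable m : {measure set (path_space X) -> \bar R}.
Variable M : nat -> path_space X -> R.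
Hypothesis M0 : forall t w, (0 <= M t w)%R.
Hypothesis superM : supermartingale m M.

Lemma supermartingale_integral_le t (A : set (path_space X)) : history t A ->
  \int[m]_(w in A) (M t.+1 w)%:E <= \int[m]_(w in A) (M t w)%:E.
Proof.
move=> hA; have mA := history_measurable hA.
have [hM _ /(_ _ _ (leqnSn t)) [C [hC _ /(_ _ hA) <-] CM]] := superM.
have mC : measurable_fun setT (EFin \o C).
  by apply/measurable_EFinP; exact: history_measurable_fun hC.
rewrite integralE; apply: (@le_trans _ _ (\int[m]_(w in A) (EFin \o C)^\+ w)).
  by rewrite -[leRHS]adde0 leeD2l// leeNl oppe0; exact: integral_ge0.
apply: ae_ge0_le_integral => //.
- by apply: measurable_funepos; exact: measurable_funS mC.
- by move=> w _; rewrite lee_fin.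
- apply/measurable_EFinP; apply: (@measurable_funS _ _ _ _ setT) => //.
  exact: history_measurable_fun (@hM t).
- apply: filterS CM => w CMw _.
  by rewrite funeposE /= ge_max !lee_fin CMw M0.
Qed.

End supermartingale_integral.

Lemma rat_between_ereal {R : realType} (x y : \bar R) : 0 <= x -> x < y ->
  exists q : rat, x < (ratr q)%:E < y.
Proof.
case: x => [r||]//= _; last by rewrite ltNge leey.
case: y => [s||]//.
  rewrite lte_fin => /rat_in_itvoo [q]; rewrite in_itv /= => /andP[rq qs].
  by exists q; rewrite !lte_fin rq.
have /rat_in_itvoo [q] : (r < r + 1)%R by rewrite ltrDl.
by rewrite in_itv /= => /andP[rq qs] _; exists q; rewrite lte_fin rq ltry.
Qed.

Section upcrossings.
Context {R : realType} {X : ptopologicalType}.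
Variable m : {measure set (path_space X) -> \bar R}.
Hypothesis mfin : m setT < +oo.
Variable G : nat -> path_space X -> R.
Hypothesis G0 : forall t w, (0 <= G t w)%R.
Hypothesis hG : forall t (B : set R), measurable B -> history t (G t @^-1` B).
Hypothesis superG : forall t (A : set (path_space X)), history t A ->
  \int[m]_(w in A) (G t.+1 w)%:E <= \int[m]_(w in A) (G t w)%:E.

Let mG t : measurable_fun setT (G t).
Proof. exact: history_measurable_fun (@hG t). Qed.

Section one_level.
Variables lo hi : R.
Hypotheses (lo0 : (0 <= lo)%R) (lohi : (lo < hi)%R).

(* Whether an upcrossing of the interval from lo to hi is under way at time
   [t], and the number of those completed so far. *)
Let crossing w := fix crossing t : bool * nat :=
  if t is s.+1 then
    let: (c, u) := crossing s in
    if c then if (hi < G t w)%R then (false, u.+1) else (true, u)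
    else if (G t w < lo)%R then (true, u) else (false, u)
  else (false, 0%N).

Let crossing_history t i : history t [set w | crossing w t = i].
Proof.
elim: t i => [|t IH] i.
  rewrite (_ : mkset _ = [set w | (false, 0%N) = i /\ setT w]).
    by apply: (@measurable_and _ (@observed_paths X 0)) => _; exact: measurableT.
  by apply/seteqP; split=> w //= [].
have mhi : history t.+1 [set w | (hi < G t.+1 w)%R].
  rewrite (_ : mkset _ = G t.+1 @^-1` `]hi, +oo[); first exact: hG.
  by apply/seteqP; split=> w /=; rewrite in_itv/= andbT.
have mlo : history t.+1 [set w | (G t.+1 w < lo)%R].
  rewrite (_ : mkset _ = G t.+1 @^-1` `]-oo, lo[); first exact: hG.
  by apply/seteqP; split=> w /=; rewrite in_itv.
pose next (j : bool * nat) (b1 b2 : bool) : bool * nat :=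
  if j.1 then if b1 then (false, j.2.+1) else (true, j.2)
  else if b2 then (true, j.2) else (false, j.2).
pose K (b : bool) (A : set (@observed_paths X t.+1)) := if b then A else ~` A.
rewrite (_ : mkset _ = [set w | exists jb : (bool * nat) * (bool * bool),
    [set w | next jb.1 jb.2.1 jb.2.2 = i /\
       ([set w | crossing w t = jb.1] `&`
       (K jb.2.1 [set w | (hi < G t.+1 w)%R] `&`
        K jb.2.2 [set w | (G t.+1 w < lo)%R])) w] w]).
  apply: (@measurable_exists _ (@observed_paths X t.+1)) => -[j [b1 b2]].
  apply: (@measurable_and _ (@observed_paths X t.+1)) => _; apply: measurableI.
    exact: (history_le (leqnSn t) (IH j)).
  by apply: measurableI; rewrite /K /=; [case: b1|case: b2] => //;
    exact: measurableC.
apply/seteqP; split=> w /=.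
  move=> wi; exists (crossing w t, ((hi < G t.+1 w)%R, (G t.+1 w < lo)%R)).
  split; first by move: wi; rewrite /next /=; case: (crossing w t).
  split=> //; rewrite /K /=; split.
    by case: ifP => // /negP.
  by case: ifP => // /negP.
move=> [[j [b1 b2]] [/= <- [<- [K1 K2]]]].
have -> : b1 = (hi < G t.+1 w)%R.
  by move: K1; rewrite /K; case: b1 => //= /negP/negbTE ->.
have -> : b2 = (G t.+1 w < lo)%R.
  by move: K2; rewrite /K; case: b2 => //= /negP/negbTE ->.
by rewrite /next; case: (crossing w t).
Qed.

Let count w t := (crossing w t).2.
Let under_way w t := (crossing w t).1.

(* V is a nonnegative process bounding the upcrossings; W t is V t with G
   moved one step ahead. *)
Let V t w : R :=
  ((hi - lo) * (count w t)%:R + (if under_way w t then G t w else lo))%R.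

Let W t w : R :=
  ((hi - lo) * (count w t)%:R + (if under_way w t then G t.+1 w else lo))%R.

Let d0 : (0 <= hi - lo)%R. Proof. by rewrite subr_ge0 ltW. Qed.

Let V0 t w : (0 <= V t w)%R.
Proof. by rewrite addr_ge0// ?mulr_ge0//; case: ifP. Qed.

Let W0 t w : (0 <= W t w)%R.
Proof. by rewrite addr_ge0// ?mulr_ge0//; case: ifP. Qed.

Let V_le_W t w : (V t.+1 w <= W t w)%R.
Proof.
rewrite /V /W /count /under_way /=; case: (crossing w t) => -[] u /=.
  case: ifPn => /= [hiG|//].
  by rewrite -natr1 mulrDr mulr1 -addrA subrK lerD2l ltW.
by case: ifPn => /= [/ltW|]; rewrite ?lerD2l.
Qed.

Let measurable_V (k : bool -> nat -> path_space X -> R) t :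
  (forall c u, measurable_fun setT (k c u)) ->
  measurable_fun setT (fun w => k (under_way w t) (count w t) w).
Proof.
move=> mk; apply: (measurable_fun_cases (c := fun w => crossing w t)
  (f := fun i => k i.1 i.2)) => // i.
exact: history_measurable (@crossing_history t i).
Qed.

Let mV t : measurable_fun setT (fun w => (V t w)%:E).
Proof.
apply/measurable_EFinP; apply: (measurable_V (k := fun c u w =>
  ((hi - lo) * u%:R + (if c then G t w else lo))%R)) => c u.
by apply: measurable_funD => //; case: c.
Qed.

Let mW t : measurable_fun setT (fun w => (W t w)%:E).
Proof.
apply/measurable_EFinP; apply: (measurable_V (k := fun c u w =>
  ((hi - lo) * u%:R + (if c then G t.+1 w else lo))%R)) => c u.
by apply: measurable_funD => //; case: c.
Qed.

Let mcount t : measurable_fun setT (fun w => ((hi - lo) * (count w t)%:R)%:E).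
Proof.
by apply/measurable_EFinP; apply: (measurable_V (k := fun c u w =>
  ((hi - lo) * u%:R)%R)).
Qed.

Let int_V t : \int[m]_w (V t w)%:E <= lo%:E * m setT.
Proof.
elim: t => [|t IH].
  rewrite -integral_cst// le_eqVlt; apply/orP; left; apply/eqP.
  by apply: eq_integral => w _; rewrite /V /= mulr0 add0r.
apply: le_trans IH; apply: (@le_trans _ _ (\int[m]_w (W t w)%:E)).
  by apply: ge0_le_integral => // w _; rewrite lee_fin.
pose E := [set w : path_space X | under_way w t].
have hE : history t E.
  rewrite (_ : E = [set w | exists u, [set w | crossing w t = (true, u)] w]).
    apply: (@measurable_exists _ (@observed_paths X t)) => u.
    exact: crossing_history.
  apply/seteqP; split=> w; rewrite /E /under_way /=; last by case=> u ->.
  by case: (crossing w t) => -[]// u _; exists u.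
have mE := history_measurable hE.
apply: (le_integral_off mE) => //; try by move=> w; rewrite lee_fin.
  by move=> w /negP/negbTE nE; rewrite /V /W nE.
have splitE s (Z : path_space X -> R) :
    (forall w, E w -> Z w = (hi - lo) * (count w t)%:R + G s w)%R ->
    \int[m]_(w in E) (Z w)%:E =
    \int[m]_(w in E) ((hi - lo) * (count w t)%:R)%:E +
    \int[m]_(w in E) (G s w)%:E.
  move=> ZE; rewrite -ge0_integralD//.
  - by apply: eq_integral => w /set_mem /ZE ->.
  - by move=> w _; rewrite lee_fin mulr_ge0.
  - exact: measurable_funS (mcount t).
  - by move=> w _; rewrite lee_fin.
  - by apply: (@measurable_funS _ _ _ _ setT) => //; apply/measurable_EFinP.
rewrite (splitE t.+1 (W t)); last by move=> w Ew; rewrite /W ifT.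
rewrite (splitE t (V t)); last by move=> w Ew; rewrite /V ifT.
by rewrite leeD2l// superG.
Qed.

Let count_le w s t : (s <= t)%N -> (count w s <= count w t)%N.
Proof.
move=> /subnKC <-; elim: (t - s)%N => [|n IH]; first by rewrite addn0.
apply: leq_trans IH _; rewrite addnS /count /=.
by case: (crossing w _) => -[] u; case: ifP => //=.
Qed.

Let unbounded := [set w : path_space X | forall k, exists t, (k <= count w t)%N].

Let unbounded0 : m unbounded = 0 /\ measurable unbounded.
Proof.
have mU : measurable unbounded.
  apply: (measurable_forall (A := fun k => [set w : path_space X |
    exists t, (k <= count w t)%N])) => k.
  apply: (measurable_exists (A := fun t => [set w : path_space X |
    (k <= count w t)%N])) => t.
  rewrite (_ : mkset _ = [set w | exists i,
      [set w | (k <= i.2)%N /\ [set w | crossing w t = i] w] w]).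
    apply: measurable_exists => i; apply: measurable_and => _.
    exact: history_measurable (@crossing_history t i).
  apply/seteqP; split=> w /=; first by exists (crossing w t).
  by move=> [i [ki wi]]; rewrite /count wi.
(* V tends to +oo wherever the count is unbounded; Fatou's lemma applies. *)
split=> //; pose F := (fun=> +oo : \bar R) \_ unbounded.
have F0 w : 0 <= F w by rewrite /F patchE; case: ifP => // _; rewrite leey.
have : \int[m]_w F w <= lo%:E * m setT.
  apply: (fatou_le (Y := fun t w => (V t w)%:E)) => //.
  - by apply/(measurable_restrictT _ mU); exact: measurable_cst.
  apply: aeW => w; rewrite /F patchE; case: ifPn => [/set_mem Uw|_]; last first.
    by apply: le_trans (einfs_le_limn_einf _ 0%N); apply: le_einfs => t _;
      rewrite lee_fin.
  have large r : r%:E <= limn_einf (fun t => (V t w)%:E).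
    have [k rk] : exists k : nat, (r <= (hi - lo) * k%:R)%R.
      exists (Num.bound (`|r| / (hi - lo))).
      rewrite mulrC -ler_pdivrMr ?subr_gt0//; apply/ltW.
      have := @archi_boundP R (`|r| / (hi - lo)) (divr_ge0 (normr_ge0 _) d0).
      apply: le_lt_trans.
      by rewrite ler_pM2r ?invr_gt0 ?subr_gt0// ler_norm.
    have [s ks] := Uw k.
    apply: le_trans (einfs_le_limn_einf _ s); apply: le_einfs => t st.
    rewrite lee_fin (le_trans rk)// -[leLHS]addr0 lerD//; last by case: ifP.
    by rewrite ler_wpM2l// ler_nat (leq_trans ks)// count_le.
  move: large; case: limn_einf => [r||]// large.
    by have := large (r + 1)%R; rewrite lee_fin gerDl ler10.
  by have := large 0%R.
rewrite -integral_mkcond integral_cst//.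
have [->//|mU0] := eqVneq (m unbounded) 0.
rewrite gt0_mulye ?lt0e ?mU0 ?measure_ge0// leye_eq => /eqP h.
have := lte_mul_pinfty (lo0 : 0 <= lo%:E) isT mfin.
by rewrite h ltxx.
Qed.

Lemma negligible_upcrossings :
  m.-negligible [set w | limn_einf (fun t => (G t w)%:E) < lo%:E /\
                         hi%:E < limn_esup (fun t => (G t w)%:E)].
Proof.
exists unbounded; split; [by case: unbounded0|by case: unbounded0|].
move=> w [Glo Ghi].
have below n : exists2 t, (n <= t)%N & (G t w < lo)%R.
  have /ereal_inf_lt [_ [t /= nt <-] h] := le_lt_trans (einfs_le_limn_einf _ n) Glo.
  by exists t.
have above n : exists2 t, (n <= t)%N & (hi < G t w)%R.
  have /ereal_sup_gt [_ [t /= nt <-] h] := lt_le_trans Ghi (limn_esup_le_esups _ n).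
  by exists t.
elim=> [|k [t kt]]; first by exists 0%N.
(* If the count stayed at [k] from time [t] on, an upcrossing would start at
   the next visit below lo, and be completed at a later one above hi. *)
apply: contrapT => no.
have stuck s : (t <= s)%N -> count w s = k.
  move=> ts; apply/eqP; rewrite eqn_leq (leq_trans kt) ?count_le// andbT.
  by rewrite leqNgt; apply/negP => ks; apply: no; exists s.
have [s ts slo] := below t.+1.
have ways : under_way w s.
  case: s ts slo => // s ts slo; have := stuck _ (leqW ts).
  have hiG : (hi < G s.+1 w)%R = false.
    by apply/negbTE; rewrite -leNgt ltW// (lt_trans slo).
  by rewrite /under_way /count /=; case: (crossing w s) => -[] u; rewrite ?hiG ?slo.
have way_stuck r : (s <= r)%N -> under_way w r.
  move=> /subnKC <-; elim: (r - s)%N => [|n IH]; first by rewrite addn0.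
  have tsn : (t <= s + n)%N by rewrite (leq_trans (ltnW ts))// leq_addr.
  have := stuck _ tsn; have := stuck _ (leqW tsn); move: IH.
  rewrite addnS /count /under_way /=; case: (crossing w _) => -[] u //= _.
  by case: ifP => //= _ <- /n_Sn.
have [r sr rhi] := above s.+1.
case: r sr rhi => // r sr rhi.
have tr : (t <= r)%N by rewrite (leq_trans (ltnW ts)).
have := way_stuck r sr; have := stuck _ tr; have := stuck _ (leqW tr).
rewrite /count /under_way /= rhi; by case: (crossing w r) => -[] u //= <- /n_Sn.
Qed.

End one_level.

Lemma ae_supermartingale_cvg :
  {ae m, forall w, limn_esup (fun t => (G t w)%:E) <=
                   limn_einf (fun t => (G t w)%:E)}.
Proof.
pose N (q : rat * rat) : set (path_space X) :=
  [set w | (0 <= ratr q.1 :> R)%R && (ratr q.1 < ratr q.2 :> R)%R /\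
    (limn_einf (fun t => (G t w)%:E) < (ratr q.1)%:E /\
     (ratr q.2)%:E < limn_esup (fun t => (G t w)%:E))].
apply: (@negligibleS _ _ _ _ [set w | exists q, N q w]).
  move=> w /negP; rewrite -ltNge => lt.
  have einf0 : 0 <= limn_einf (fun t => (G t w)%:E).
    by apply: le_trans (einfs_le_limn_einf _ 0%N); apply: le_einfs => t _;
      rewrite lee_fin.
  have [q1 /andP[lq1 q1u]] := rat_between_ereal einf0 lt.
  have q10 := ltW (le_lt_trans einf0 lq1).
  have [q2 /andP[q12 q2u]] := rat_between_ereal q10 q1u.
  exists (q1, q2); split=> /=; last by split.
  by apply/andP; split.
apply: negligible_exists => -[q1 q2].
have [/andP[q10 q12]|nq] := boolP ((0 <= ratr q1 :> R)%R && (ratr q1 < ratr q2 :> R)%R).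
  by apply: negligibleS (negligible_upcrossings q10 q12) => w [_].
apply: (@negligibleS _ _ _ _ set0); last exact: negligible_set0.
by move=> w []; rewrite (negbTE nq).
Qed.

End upcrossings.

(** * A player gains when the opponent stops more often *)

Section larger_opponent.
Context {R : realType} {X : ptopologicalType}.
Variables (P : R.-pker (borel X) ~> (path_space X)) (a : payoff R (borel X)).
Hypothesis adm : admissible P a.
Hypothesis ord : forall x, (lead a x <= both a x <= follow a x)%R.
Hypothesis super : forall x,
  supermartingale (P x) (fun t w => (discount a t * follow a (w t))%R).
Implicit Types (w : path_space X).

Let disc : discount_function (discount a). Proof. by case: adm. Qed.
Let a0 x : [/\ (0 <= lead a x)%R, (0 <= follow a x)%R & (0 <= both a x)%R].
Proof. by case: adm. Qed.
Let ma : [/\ measurable_fun setT (lead a), measurable_fun setT (follow a)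
           & measurable_fun setT (both a)].
Proof. by case: adm. Qed.

Variables (T T' S : set (borel X)).
Hypotheses (mT : measurable T) (mT' : measurable T') (mS : measurable S).
Hypothesis TT' : T `<=` T'.

Let B := S `|` T.
Let B' := S `|` T'.
Let mB : measurable B. Proof. exact: measurableU. Qed.
Let mB' : measurable B'. Proof. exact: measurableU. Qed.
Let BB' y : B y -> B' y. Proof. by move=> [Sy|/TT']; [left|right]. Qed.

Let d0 t : (0 <= discount a t)%R. Proof. exact/ltW/discount_gt0. Qed.

Let G t w := (discount a t * follow a (w t))%R.
Let G0 t w : (0 <= G t w)%R.
Proof. by rewrite mulr_ge0//; have [] := a0 (w t). Qed.
Let mG t : measurable_fun setT (fun w => (G t w)%:E).
Proof. by apply: measurable_reward; case: ma. Qed.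

Let F w := stop_pay a (reward a T) [set t | B (w t)] w.
Let F' w := stop_pay a (reward a T') [set t | B' (w t)] w.
Let F0 w : 0 <= F w. Proof. by apply: stop_pay_ge0 => // y; exact: reward_ge0. Qed.
Let F'0 w : 0 <= F' w. Proof. by apply: stop_pay_ge0 => // y; exact: reward_ge0. Qed.
Let mF : measurable_fun setT F. Proof. exact: measurable_visits_pay. Qed.
Let mF' : measurable_fun setT F'. Proof. exact: measurable_visits_pay. Qed.

(* By time [n], B' has been visited but B has not. *)
Let A n : set (path_space X) :=
  [set w | (exists s, (0 < s <= n)%N /\ B' (w s)) /\
           (forall t, (0 < t <= n)%N -> ~ B (w t))].

Let historyA n : history n (A n).
Proof.
rewrite (_ : A n =
   [set w | exists s, [set w | (0 < s <= n)%N /\ [set w | B' (w s)] w] w] `&`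
   [set w | forall t, (0 < t <= n)%N -> (~` [set w | B (w t)]) w])//.
apply: (@measurableI _ (@observed_paths X n)).
  apply: (@measurable_exists _ (@observed_paths X n) nat) => s.
  apply: (@measurable_and _ (@observed_paths X n)) => /andP[_ sn].
  exact: history_coordinate.
apply: (@measurable_forall _ (@observed_paths X n)) => t.
apply: (@measurable_imp _ (@observed_paths X n)) => /andP[_ tn].
by apply: measurableC; exact: history_coordinate.
Qed.

Let mA n : measurable (A n). Proof. exact: history_measurable (@historyA n). Qed.

(* Interpolation between F' and F: after a visit to B' outside B, the reward
   [follow] is collected at the first visit to B or at time [n], whichever
   comes first. *)
Let H := fix H n w : \bar R :=
  if n is k.+1 then if w \in A k then (G n w)%:E else H k w else F' w.

Let H0 n w : 0 <= H n w.
Proof.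
by elim: n => [|n IH] /=; [exact: F'0|case: ifP => // _; rewrite lee_fin].
Qed.

Let mH n : measurable_fun setT (H n).
Proof.
elim: n => [|n IH]; first exact: mF'.
rewrite (_ : H n.+1 = fun w => if w \in A n then (G n.+1 w)%:E else H n w)//.
apply: measurable_fun_ifT => //.
by apply: (measurable_fun_bool true); rewrite setTI preimage_mem_true.
Qed.

Let H_init n w : (forall s, (0 < s < n)%N -> ~ B' (w s)) -> H n w = F' w.
Proof.
elim: n => [//|n IH] nB' /=; rewrite memNset.
  by apply: IH => s /andP[s0 sn]; apply: nB'; rewrite s0 ltnW.
by move=> [[s [/andP[s0 sn] B's]] _]; apply: (nB' s) => //; rewrite s0.
Qed.

Let H_on n w : A n w -> H n w = (G n w)%:E.
Proof.
case: n => [[[s [/andP[s0]]]]|n [[s [/andP[s0 sn] B's]] nB]].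
  by rewrite leqNgt s0.
rewrite /=; case: ifPn => // /negP nA.
have nB' r : (0 < r < n.+1)%N -> ~ B' (w r).
  move=> /andP[r0 rn] B'r; apply: nA; apply: mem_set; split.
    by exists r; rewrite r0.
  by move=> t /andP[t0 tn]; apply: nB; rewrite t0 leqW.
have es : s = n.+1.
  apply/eqP; rewrite eqn_leq sn ltnNge; apply/negP => sn'.
  by apply: (nB' s) => //; rewrite s0.
rewrite -[H n w]/(H n w) H_init; last first.
  by move=> r /andP[r0 rn]; apply: nB'; rewrite r0 ltnW.
subst s; rewrite /F' (@stop_payE _ _ _ _ _ _ n.+1)//; congr ((_ * _)%:E).
rewrite /reward mem_set//; case: B's => // Ss; exfalso.
by apply: (nB n.+1); [rewrite leqnn|left].
Qed.

Let step x n : \int[P x]_w H n.+1 w <= \int[P x]_w H n w.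
Proof.
apply: (le_integral_off (mA n)) => //.
  by move=> w nA /=; rewrite memNset.
have superG := supermartingale_integral_le G0 (super x) (@historyA n).
rewrite (eq_integral (fun w => (G n.+1 w)%:E)); last by move=> w /= ->.
by rewrite [leRHS](eq_integral (fun w => (G n w)%:E))// => w /set_mem /H_on.
Qed.

Let reward_mono y : (reward a T y <= reward a T' y)%R.
Proof.
rewrite /reward; have [/set_mem/TT' Ty|_] := boolP (y \in T); first by rewrite mem_set.
by case: ifP => // _; case/andP: (ord y) => /le_trans; exact.
Qed.

Let reward_follow y : (reward a T y <= follow a y)%R.
Proof.
by rewrite /reward; case: ifP => // _; case/andP: (ord y) => /le_trans; exact.
Qed.

Let limit w :
  limn_esup (fun t => (G t w)%:E) <= limn_einf (fun t => (G t w)%:E) ->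
  F w <= limn_einf (H ^~ w).
Proof.
move=> cvgG.
have const n c : (forall k, (n <= k)%N -> H k w = c) -> c <= limn_einf (H ^~ w).
  move=> Hc; apply: le_trans (einfs_le_limn_einf _ n).
  by apply: le_einfs => k /Hc ->.
rewrite /F /stop_pay; case: (first_timeP [set t | B' (w t)]) => [s s0 B's smin|nB'].
  have [Bs|nBs] := pselect (B (w s)).
    (* B and B' are first visited together, and H is constant. *)
    rewrite (@first_timeE _ s)//; last first.
      by move=> r rs /BB'; exact: smin.
    apply: (@le_trans _ _ (F' w)).
      by rewrite /F' (@stop_payE _ _ _ _ _ _ s)// lee_fin ler_wpM2l.
    apply: (const 0%N) => n _; elim: n => [//|n IH] /=.
    rewrite memNset// => -[[r [/andP[r0 rn] B'r]] nB].
    have [rs|sr] := ltnP r s; first by apply: (smin r) => //; rewrite r0.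
    by apply: (nB s) => //; rewrite s0 (leq_trans sr).
  case: first_timeP => [r r0 Br rmin|nB].
    (* B is first visited at time [r], later than B': H is constant from then. *)
    have sr : (s < r)%N.
      rewrite ltn_neqAle; apply/andP; split.
        by apply/eqP => es; apply: nBs; rewrite es.
      by rewrite leqNgt; apply/negP => rs; apply: (smin r); [rewrite r0|exact: BB'].
    apply: (@le_trans _ _ (G r w)%:E); first by rewrite lee_fin ler_wpM2l.
    apply: (const r) => n /subnKC <-; elim: (n - r)%N => [|k IH].
      rewrite addn0; case: r r0 Br rmin sr => // r r0 Br rmin sr.
      rewrite /= mem_set//; split; first by exists s; rewrite s0.
      by move=> t /andP[t0 tr]; apply: rmin; rewrite t0.
    rewrite addnS /= memNset// => -[_ /(_ r)]; apply => //.
    by rewrite r0 leq_addr.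
  (* B is never visited, so that H follows G from time [s] on. *)
  have An n : (s <= n)%N -> A n w.
    move=> sn; split; first by exists s; rewrite s0.
    by move=> t /andP[t0 _]; exact: nB.
  apply: (@le_trans _ _ (limn_esup (fun t => (G t w)%:E))).
    apply: le_limn_esup => t; rewrite lee_fin ler_wpM2l//.
    by case/andP: (ord (w t)).
  apply: le_trans cvgG _; apply: limn_einf_le_lim => n.
  apply: le_trans (einfs_le_limn_einf _ (maxn n s)).
  apply: le_einfs => k; rewrite geq_max => /andP[nk /An/H_on ->].
  by apply: ereal_inf_lbound; exists k.
rewrite first_timeN; last by move=> t /nB' + /BB'.
apply: (const 0%N) => n _; rewrite H_init; last by move=> r /andP[/nB'].
by rewrite /F' stop_payN.
Qed.

(** Stopping by the opponent on [T'] instead of [T] pays [follow] earlier, which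
    is favourable because the discounted [follow] is a supermartingale. Its
    almost sure convergence settles the paths that never reach [T]. *)
Lemma value_le_opponent x : value P a T S x <= value P a T' S x.
Proof.
apply: (fatou_le (Y := H)) => //; last first.
  elim => [|n IH]; first exact: lexx.
  exact: le_trans (step x n) IH.
have Pfin : P x setT < +oo by rewrite prob_kernel ltry.
have hG t (C : set R) : measurable C -> history t (G t @^-1` C).
  by case: (super x) => h _ _; exact: h.
have [N [mN N0 cvgG]] := ae_supermartingale_cvg Pfin G0 hG
  (fun t A hA => supermartingale_integral_le G0 (super x) hA).
exists N; split => //; apply: subset_trans cvgG; apply: subsetC => w.
exact: limit.
Qed.

End larger_opponent.

(** * Optimal responses *)

Section null_sets.
Context {R : realType} {X : ptopologicalType}.
Variables (P : R.-pker (borel X) ~> (path_space X)).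
Variable mu : {sigma_finite_measure set (borel X) -> \bar R}.
Variable p : nat -> X -> X -> R.
Hypothesis densP : transition_density P mu p.

Lemma ae_avoid_null (N : set (borel X)) x : measurable N -> mu N = 0 ->
  {ae P x, forall w, forall t, (0 < t)%N -> ~ N (w t)}.
Proof.
move=> mN N0; apply: (@negligibleS _ _ _ _
  [set w : path_space X | exists t, [set w : path_space X | (0 < t)%N /\ N (w t)] w]).
  move=> w /= /existsNP[t /not_implyP[t0 /contrapT Nt]]; by exists t.
apply: negligible_exists => t.
have [t0|t0] := ltnP 0 t; last first.
  apply: (@negligibleS _ _ _ _ set0); last exact: negligible_set0.
  by move=> w [].
apply: (@negligibleS _ _ _ _ [set w : path_space X | N (w t)]).
  by move=> w [].
have [p0 mp /(_ x N mN) PxN] := densP t0.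
apply/negligibleP; first exact: measurable_at.
rewrite -[LHS]/(P x [set w : path_space X | N (w t)]) PxN.
apply: null_set_integral => //; apply: (@measurable_funS _ _ _ _ setT) => //.
apply/measurable_EFinP; exact: (measurableT_comp mp (measurable_pair1 x)).
Qed.

Variable a : payoff R (borel X).
Hypothesis adm : admissible P a.

Let disc : discount_function (discount a). Proof. by case: adm. Qed.
Let a0 x : [/\ (0 <= lead a x)%R, (0 <= follow a x)%R & (0 <= both a x)%R].
Proof. by case: adm. Qed.
Let ma : [/\ measurable_fun setT (lead a), measurable_fun setT (follow a)
           & measurable_fun setT (both a)].
Proof. by case: adm. Qed.

(** Continuation values do not see modifications of the two stopping sets on
    a null set. *)
Lemma value_eq_null (T T' S S' N : set (borel X)) x :
  measurable T -> measurable T' -> measurable S -> measurable S' ->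
  measurable N -> mu N = 0 ->
  (forall y, ~ N y -> (T y <-> T' y) /\ ((S `|` T) y <-> (S' `|` T') y)) ->
  value P a T S x = value P a T' S' x.
Proof.
move=> mT mT' mS mS' mN N0 eqN.
apply: (ge0_eq_integral_ae _ _ _ _ (ae_avoid_null x mN N0)) => //.
- exact: measurable_visits_pay.
- exact: measurable_visits_pay.
- by move=> w; apply: stop_pay_ge0 => // y; exact: reward_ge0.
- by move=> w; apply: stop_pay_ge0 => // y; exact: reward_ge0.
move=> w nN; rewrite (@eq_stop_pay _ _ _ _ _ [set t | (S' `|` T') (w t)]); last first.
  by move=> t /nN /eqN [].
rewrite /stop_pay; case: first_timeP => [t t0 _ _|//].
congr ((_ * _)%:E); have [TT' _] := eqN _ (nN t t0).
rewrite /reward; case: ifPn => [/set_mem/TT'/mem_set ->//|/negP nT].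
by rewrite memNset// => /TT'/mem_set.
Qed.

End null_sets.

Section best_policy.
Context {R : realType} {X : ptopologicalType}.
Hypothesis polX : polish R X.
Variables (P : R.-pker (borel X) ~> (path_space X)).
Hypothesis markovP : strong_markov P.
Variable mu : {sigma_finite_measure set (borel X) -> \bar R}.
Variable p : nat -> X -> X -> R.
Hypothesis densP : transition_density P mu p.
Variable a : payoff R (borel X).
Hypothesis adm : admissible P a.
Hypothesis ord : forall x, (lead a x <= both a x <= follow a x)%R.
Implicit Types (S T : set (borel X)).

Let ma : [/\ measurable_fun setT (lead a), measurable_fun setT (follow a)
           & measurable_fun setT (both a)].
Proof. by case: adm. Qed.

(** The policies under which waiting is at least as good as stopping everywhere
    outside the stopping sets of the two players: the half of the equilibrium
    condition that survives intersections. *)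
Definition waiting T S : Prop := measurable S /\
  forall y, ~ (S `|` T) y -> (lead a y)%:E <= value P a T S y.

Lemma waiting_bigcap T (S : nat -> set (borel X)) : measurable T ->
  (forall n, waiting T (S n)) ->
  waiting T (\bigcap_n S n) /\
  forall m x, value P a T (S m) x <= value P a T (\bigcap_n S n) x.
Proof.
move=> mT wS; have mS n : measurable (S n) by case: (wS n).
have mI : measurable (\bigcap_n S n) by exact: bigcapT_measurable.
have goon y : ~ ((\bigcap_n S n) `|` T) y ->
    exists n, (lead a y)%:E <= value P a T (S n) y.
  move=> nST; have nT : ~ T y by move=> Ty; apply: nST; right.
  have /existsNP[n nSn] : ~ forall n, S n y by move=> Sy; apply: nST; left.
  by exists n; apply: (wS n).2 => -[].
have le m x := value_improvement polX markovP adm ord m mT mI mS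
  (fun n => bigcap_inf (Logic.I : setT n)) goon x.
split; last exact: le.
by split=> // y /goon [n /le_trans]; apply; exact: le.
Qed.

(** A waiting policy minimal up to null sets is optimal: intersecting it with
    any other one improves the latter and changes the former by a null set. *)
Lemma best_waiting T : measurable T -> exists S, waiting T S /\
  forall S', waiting T S' -> forall x, value P a T S' x <= value P a T S x.
Proof.
move=> mT.
have [|||S wS maxS] := @exhaustion _ _ _ mu [set S | waiting T (~` S)].
- by exists set0; rewrite /= setC0; split=> // y; case; left.
- by move=> S [mS _]; rewrite -[S]setCK; exact: measurableC.
- by move=> S wS; rewrite /= setC_bigcup; apply: (waiting_bigcap mT wS).1.
exists (~` S); split=> // S' wS' x; have [mS' _] := wS'.
have mS : measurable (~` S) by case: wS.
pose S2 n := if n is 0%N then S' else ~` S.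
have wS2 n : waiting T (S2 n) by case: n.
have [[mI _] le] := waiting_bigcap mT wS2.
apply: le_trans (le 0%N x) _; rewrite le_eqVlt; apply/orP; left; apply/eqP.
have mN : measurable (~` S `\` S') by exact: measurableD.
apply: (value_eq_null densP adm _ mT mT mI mS mN).
  have -> : ~` S `\` S' = ~` S' `\` S by rewrite !setDE setIC.
  by apply: maxS; rewrite /= setCK.
move=> y nN; split=> //; split=> -[Sy|Ty]; try by right.
  by left; exact: (Sy 1%N).
by left=> -[|n] _ //=; apply: contrapT => S'y; apply: nN.
Qed.

(** The largest continuation value against [T], attained simultaneously at all
    points by one waiting policy. The value 0 for a nonmeasurable [T] is
    immaterial. *)
Definition best T x : \bar R :=
  match pselect (measurable T) with
  | left mT => value P a T (projT1 (cid (best_waiting mT))) x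
  | right _ => 0
  end.

(** The least optimal response to [T]: stop exactly where this beats the best
    continuation value. *)
Definition response T : set (borel X) :=
  [set y | ~ T y /\ best T y < (lead a y)%:E].

Lemma bestP T : measurable T -> exists S, [/\ waiting T S,
  best T =1 value P a T S &
  forall S', waiting T S' -> forall x, value P a T S' x <= best T x].
Proof.
move=> mT; rewrite /best; case: pselect => // mT'.
by case: cid => S /= [wS maxS]; exists S; split.
Qed.

Lemma measurable_lt_lead (v : borel X -> \bar R) : measurable_fun setT v ->
  measurable [set y | v y < (lead a y)%:E].
Proof.
move=> mv; rewrite -[X in measurable X]setTI; apply: measurable_lte => //.
by apply/measurable_EFinP; case: ma.
Qed.

Lemma measurable_best T : measurable T -> measurable_fun setT (best T).
Proof.
move=> mT; have [S [[mS _] /funext -> _]] := bestP mT.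
by apply: measurable_value => //; case: adm.
Qed.

Lemma measurable_response T : measurable T -> measurable (response T).
Proof.
move=> mT; have mT' := measurableC mT.
exact: measurableI mT' (measurable_lt_lead (measurable_best mT)).
Qed.

Lemma waiting_response T : measurable T ->
  waiting T (response T) /\ best T =1 value P a T (response T).
Proof.
move=> mT; have mR := measurable_response mT.
have [S [[mS wS] bE maxS]] := bestP mT.
have RS : response T `<=` S.
  move=> y [nTy lt]; apply: contrapT => nSy.
  by move: lt; rewrite bE ltNge wS// => -[].
have off y : ~ (response T `|` T) y -> (lead a y)%:E <= best T y.
  move=> nRT; rewrite leNgt; apply/negP => lt; apply: nRT.
  by have [Ty|nTy] := pselect (T y); [right|left].
have le x : best T x <= value P a T (response T) x.
  rewrite bE; apply: (value_improvement polX markovP adm ord 0%N mT mR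
    (S := fun=> S)) => // y /off; rewrite bE => ?.
  by exists 0%N.
have wR : waiting T (response T).
  by split=> // y /off /le_trans; apply.
split=> // x; apply/eqP; rewrite eq_le le/=; exact: maxS.
Qed.

Hypothesis super : forall x,
  supermartingale (P x) (fun t w => (discount a t * follow a (w t))%R).

(** The restriction to [~` T'] of the optimal response to [T] is a waiting
    policy against [T']. *)
Lemma best_le T T' x : measurable T -> measurable T' -> mu (T `\` T') = 0 ->
  best T x <= best T' x.
Proof.
move=> mT mT' N0.
have [[mS wS] bE] := waiting_response mT; set S := response T in mS wS bE.
have mTT' : measurable (T `|` T') by exact: measurableU.
have le y : best T y <= value P a (T `|` T') S y.
  by rewrite bE; apply: (value_le_opponent adm ord super) => // z; left.
pose S2 := ~` T' `&` [set y | best T y < (lead a y)%:E].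
have mS2 : measurable S2.
  apply: measurableI; first exact: measurableC.
  exact: measurable_lt_lead (measurable_best mT).
have mN : measurable (T `\` T') by exact: measurableD.
have eq2 y : value P a (T `|` T') S y = value P a T' S2 y.
  apply: (value_eq_null densP adm y mTT' mT' mS mS2 mN N0) => z nN.
  have TT' : T z -> T' z by move=> Tz; apply: contrapT => nT'z; exact: nN.
  split; first by split=> [[/TT'//|//]|]; right.
  split=> [[[nTz lt]|[/TT'|]]|[[nT'z lt]|T'z]]; try by right.
  - by have [T'z|nT'z] := pselect (T' z); [right|left].
  - by left; split=> // /TT'.
  - by right; right.
have [S' [_ _ maxS']] := bestP mT'.
apply: le_trans (le x) _; rewrite eq2; apply: maxS'; split=> // y nS2.
rewrite -eq2; apply: le_trans (le y); rewrite leNgt; apply/negP => lt.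
apply: nS2; have [T'y|nT'y] := pselect (T' y); first by right.
by left; split.
Qed.

End best_policy.

(** * Equilibria of the game *)

Section hitting_times.
Context {X : ptopologicalType}.
Implicit Types (S : set (borel X)) (w : path_space X).

Lemma hit_plusE S w : hit_plus S w = first_time [set t | S (w t)].
Proof.
rewrite /hit_plus /hitting_from; case: pselect => [ex|nex].
  case: ex_minnP => t /andP[t0 /set_mem St] tmin; symmetry.
  apply: first_timeE => // s /andP[s0 st] Ss.
  by have := tmin s; rewrite s0 mem_set// => /(_ isT); rewrite leqNgt st.
rewrite first_timeN// => t t0 St; apply: nex.
by exists t; rewrite t0 mem_set.
Qed.

Lemma hit0 S w : S (w 0%N) -> hit S w = Some 0%N.
Proof.
move=> S0; rewrite /hit /hitting_from; case: pselect => [ex|nex].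
  case: ex_minnP => t _ /(_ 0%N); rewrite mem_set// => /(_ isT).
  by rewrite leqn0 => /eqP ->.
by exfalso; apply: nex; exists 0%N; rewrite mem_set.
Qed.

Lemma hitE S w : ~ S (w 0%N) -> hit S w = first_time [set t | S (w t)].
Proof.
move=> nS0; rewrite /hit /hitting_from; case: pselect => [ex|nex].
  case: ex_minnP => -[|t] /andP[_ /set_mem St] tmin //; symmetry.
  apply: first_timeE => // s /andP[s0 st] Ss.
  by have := tmin s; rewrite mem_set// => /(_ isT); rewrite leqNgt st.
rewrite first_timeN// => t t0 St; apply: nex.
by exists t; rewrite mem_set.
Qed.

Lemma measurable_hit_plus S o : measurable S ->
  measurable [set w : path_space X | hit_plus S w = o].
Proof.
move=> mS; under eq_set do rewrite hit_plusE.
apply: measurable_first_time => t; exact: measurable_at.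
Qed.

Lemma measurable_hit S o : measurable S ->
  measurable [set w : path_space X | hit S w = o].
Proof.
move=> mS; have m0 := @measurable_at X 0%N S mS.
rewrite (_ : mkset _ = ([set w : path_space X | S (w 0%N)] `&`
    [set w | Some 0%N = o /\ setT w]) `|`
  (~` [set w : path_space X | S (w 0%N)] `&`
    [set w | first_time [set t | S (w t)] = o])).
  apply: measurableU; apply: measurableI => //.
  - by apply: measurable_and => _; exact: measurableT.
  - exact: measurableC.
  - apply: measurable_first_time => t; exact: measurable_at.
apply/seteqP; split=> w /=.
  have [S0|nS0] := pselect (S (w 0%N)); first by rewrite hit0// => <-; left.
  by rewrite hitE// => <-; right.
by move=> [[S0 [<- _]]|[nS0 <-]]; [rewrite hit0|rewrite hitE].
Qed.

End hitting_times.

Section expected_payoffs.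
Context {R : realType} {X : ptopologicalType}.
Hypothesis polX : polish R X.
Variables (P : R.-pker (borel X) ~> (path_space X)).
Hypothesis markovP : strong_markov P.
Variable a : payoff R (borel X).
Hypothesis adm : admissible P a.
Implicit Types (S T : set (borel X)) (w : path_space X).

Let disc : discount_function (discount a). Proof. by case: adm. Qed.
Let d0 t : (0 <= discount a t)%R. Proof. exact/ltW/discount_gt0. Qed.
Let d1 : discount a 0%N = 1%R. Proof. by case: disc. Qed.
Let a0 x : [/\ (0 <= lead a x)%R, (0 <= follow a x)%R & (0 <= both a x)%R].
Proof. by case: adm. Qed.
Let ma : [/\ measurable_fun setT (lead a), measurable_fun setT (follow a)
           & measurable_fun setT (both a)].
Proof. by case: adm. Qed.

Lemma game_payoff_ge0 (tau sigma : random_time) w :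
  0 <= game_payoff a tau sigma w.
Proof.
rewrite /game_payoff; case: (tau w) => [s|]; case: (sigma w) => [t|].
- have [fs gs hs] := a0 (w s); have [ft gt ht] := a0 (w t).
  by case: (s < t)%N; [|case: (t < s)%N]; rewrite lee_fin mulr_ge0.
- by rewrite lee_fin mulr_ge0//; have [] := a0 (w s).
- by rewrite lee_fin mulr_ge0//; have [] := a0 (w t).
- exact: never_pay_ge0.
Qed.

Lemma measurable_game_payoff (tau sigma : random_time) :
  (forall o, measurable [set w : path_space X | tau w = o]) ->
  (forall o, measurable [set w : path_space X | sigma w = o]) ->
  measurable_fun setT (game_payoff a tau sigma).
Proof.
move=> mtau msigma.
have [mf mg mh] := ma.
apply: (measurable_fun_cases (c := fun w => (tau w, sigma w))
  (f := fun o w => game_payoff a (fun=> o.1) (fun=> o.2) w)).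
  move=> [i j]; rewrite (_ : mkset _ =
    [set w | tau w = i] `&` [set w | sigma w = j]); first exact: measurableI.
  by apply/seteqP; split=> w /= [-> ->].
move=> [[s|] [t|]]; rewrite /game_payoff /=.
- by case: (s < t)%N; [|case: (t < s)%N]; exact: measurable_reward.
- exact: measurable_reward.
- exact: measurable_reward.
- exact: measurable_never_pay.
Qed.

Let J_start x (tau sigma : random_time) (c : R) :
  (forall o, measurable [set w : path_space X | tau w = o]) ->
  (forall o, measurable [set w : path_space X | sigma w = o]) ->
  (0 <= c)%R ->
  (forall w, w 0%N = x -> game_payoff a tau sigma w = c%:E) ->
  J P a x tau sigma = c%:E.
Proof.
move=> mtau msigma c0 cE; rewrite /J.
rewrite (ge0_eq_integral_ae (g := cst c%:E) _ _ _ _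
  (ae_start polX markovP x)) => //.
- by rewrite integral_cst// prob_kernel mule1.
- exact: measurable_game_payoff.
- by move=> w; exact: game_payoff_ge0.
Qed.

Let measurable_now o : measurable [set w : path_space X | now w = o].
Proof.
rewrite (_ : mkset _ = [set w | Some 0%N = o /\ setT w]).
  by apply: measurable_and => _; exact: measurableT.
by apply/seteqP; split=> w //= [].
Qed.

Lemma J_now_in T x : measurable T -> T x -> J P a x now (hit T) = (both a x)%:E.
Proof.
move=> mT Tx; apply: (J_start measurable_now (fun o => measurable_hit o mT)).
  by have [] := a0 x.
move=> w wx; have hT : hit T w = Some 0%N by rewrite hit0// wx.
by rewrite /game_payoff hT /= d1 mul1r wx.
Qed.

Lemma J_plus_in S T x : measurable S -> measurable T -> T x ->
  J P a x (hit_plus S) (hit T) = (follow a x)%:E.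
Proof.
move=> mS mT Tx; apply: (J_start (fun o => measurable_hit_plus o mS)
                (fun o => measurable_hit o mT)).
  by have [] := a0 x.
move=> w wx; have hT : hit T w = Some 0%N by rewrite hit0// wx.
rewrite /game_payoff hT hit_plusE.
by case: first_timeP => [t t0 _ _|_] /=; rewrite ?t0 d1 mul1r wx.
Qed.

Lemma J_now_out T x : measurable T -> ~ T x ->
  J P a x now (hit T) = (lead a x)%:E.
Proof.
move=> mT Tx; apply: (J_start measurable_now (fun o => measurable_hit o mT)).
  by have [] := a0 x.
move=> w wx; rewrite /game_payoff hitE ?wx//.
by case: first_timeP => [t t0 _ _|_] /=; rewrite ?t0 d1 mul1r wx.
Qed.

(** Off the opponent's stopping set, the payoff of waiting is the one collected
    at the first positive time spent in either stopping set, as long as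
    stopping simultaneously is worth the same as following. *)
Lemma J_plus_out S T x : measurable S -> measurable T -> ~ T x ->
  (forall y, S y -> T y -> both a y = follow a y) ->
  J P a x (hit_plus S) (hit T) = value P a T S x.
Proof.
move=> mS mT nTx hg.
apply: (ge0_eq_integral_ae _ _ _ _ (ae_start polX markovP x)) => //.
- by apply: measurable_game_payoff => o; [exact: measurable_hit_plus|
    exact: measurable_hit].
- exact: measurable_visits_pay.
- by move=> w; exact: game_payoff_ge0.
- by move=> w; apply: stop_pay_ge0 => // y; exact: reward_ge0.
move=> w wx; rewrite /game_payoff hit_plusE hitE ?wx// /reward.
case: (first_timeP [set t | S (w t)]) => [s s0 Ss smin|nS];
  case: (first_timeP [set t | T (w t)]) => [t t0 Tt tmin|nT].
- case: (ltngtP s t) => [st|ts|est].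
  + rewrite (@stop_payE _ _ _ _ _ _ s)//; last 2 first.
    * by left.
    * move=> r /andP[r0 rs] [Sr|Tr]; first by apply: (smin r) => //; rewrite r0.
      by apply: (tmin r) => //; rewrite r0 (ltn_trans rs).
    * by rewrite memNset//; apply: tmin; rewrite s0.
  + rewrite (@stop_payE _ _ _ _ _ _ t)//; last 2 first.
    * by right.
    * move=> r /andP[r0 rt] [Sr|Tr]; last by apply: (tmin r) => //; rewrite r0.
      by apply: (smin r) => //; rewrite r0 (ltn_trans rt).
    * by rewrite mem_set.
  + subst t; rewrite (@stop_payE _ _ _ _ _ _ s)//; last 2 first.
    * by left.
    * move=> r rs [Sr|Tr]; first exact: (smin r).
      exact: (tmin r).
    * by rewrite mem_set// hg.
- rewrite (@stop_payE _ _ _ _ _ _ s)//; last 2 first.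
  + by left.
  + by move=> r rs [|]; [exact: smin|apply: nT; case/andP: rs].
  + by rewrite memNset//; exact: nT.
- rewrite (@stop_payE _ _ _ _ _ _ t)//; last 2 first.
  + by right.
  + by move=> r rt [|]; [apply: nS; case/andP: rt|exact: tmin].
  + by rewrite mem_set.
- by rewrite stop_payN// => r r0 [|]; [exact: nS|exact: nT].
Qed.

Variable mu : {sigma_finite_measure set (borel X) -> \bar R}.
Variable p : nat -> X -> X -> R.
Hypothesis densP : transition_density P mu p.
Hypothesis ord : forall x, (lead a x <= both a x <= follow a x)%R.

Lemma equilibrium_overlap T S x : measurable T -> intra_equilibria P a T S ->
  S x -> T x -> both a x = follow a x.
Proof.
move=> mT [mS ST] Sx Tx; have : Theta P a T S x by rewrite ST.
move=> [[_]|[]//]; rewrite J_now_in// J_plus_in// lee_fin => gh.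
by apply/eqP; rewrite eq_le gh andbT; case/andP: (ord x).
Qed.

Lemma equilibrium_waiting T S : measurable T -> intra_equilibria P a T S ->
  waiting P a T S.
Proof.
move=> mT eqS; have [mS ST] := eqS; split=> // y nST.
have nSy : ~ S y by move=> Sy; apply: nST; left.
have nTy : ~ T y by move=> Ty; apply: nST; right.
rewrite -(J_now_out mT nTy) -(J_plus_out mS mT nTy); last first.
  by move=> z; exact: equilibrium_overlap.
rewrite leNgt; apply/negP => lt; apply: (nSy).
have : Theta P a T S y by right.
by rewrite ST.
Qed.

Lemma response_optimal T (best_response := response polX markovP densP adm ord T) :
  measurable T -> optimal_intra_equilibria P a T best_response.
Proof.
move=> mT; have mS : measurable best_response by exact: measurable_response.
have [_ bE] := waiting_response polX markovP densP adm ord mT.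
have disj y : best_response y -> T y -> both a y = follow a y by move=> [].
have JE y : ~ T y -> J P a y (hit_plus best_response) (hit T) =
    best polX markovP densP adm ord T y.
  by move=> nTy; rewrite J_plus_out// bE.
split.
  split=> //; apply/seteqP; split=> x.
    move=> [[]//|[nSx]]; have [Tx|nTx] := pselect (T x).
      rewrite J_now_in// J_plus_in// lte_fin ltNge.
      by case/andP: (ord x) => _ ->.
    by rewrite J_now_out// JE// => lt; exfalso; apply: nSx.
  by move=> Sx; have [nTx lt] := Sx; left; split=> //; rewrite J_now_out// JE// ltW.
move=> S' eqS' x; have [mS' _] := eqS'; rewrite /U.
have [Tx|nTx] := pselect (T x); first by rewrite !J_plus_in// !J_now_in.
have [S0 [_ _ maxS]] := bestP polX markovP densP adm ord mT.
rewrite ge_max !le_max lexx /=; apply/orP; right.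
rewrite JE// J_plus_out//; first exact: maxS (equilibrium_waiting mT eqS') x.
by move=> z; exact: equilibrium_overlap.
Qed.

End expected_payoffs.

(** * Mutually optimal responses *)

Section fixed_point.
Context d (T : measurableType d) (R : realType).
Variable mu : {sigma_finite_measure set T -> \bar R}.
Implicit Types S : set T.

(** [W1] and [W2] map a stopping set of the opponent to the region where each
    player wants to stop, the response being its part off that stopping set.
    The composite of the two responses is monotone, hence has a fixed point in
    the complete lattice of measurable sets modulo null sets (Knaster-Tarski);
    the antitonicity of [W1] and [W2] up to null sets makes it exact. *)
Lemma antitone_fixed_point (W1 W2 : set T -> set T) :
  (forall S, measurable S -> measurable (W1 S)) ->
  (forall S, measurable S -> measurable (W2 S)) ->
  (forall S S', measurable S -> measurable S' -> mu (S `\` S') = 0 ->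
     W1 S' `<=` W1 S) ->
  (forall S S', measurable S -> measurable S' -> mu (S `\` S') = 0 ->
     W2 S' `<=` W2 S) ->
  exists S S', [/\ measurable S, measurable S', S = W1 S' `\` S' & S' = W2 S `\` S].
Proof.
move=> mW1 mW2 W1le W2le.
pose r1 S := W1 S `\` S; pose r2 S := W2 S `\` S.
have mr1 S : measurable S -> measurable (r1 S).
  by move=> mS; apply: measurableD => //; exact: mW1.
have mr2 S : measurable S -> measurable (r2 S).
  by move=> mS; apply: measurableD => //; exact: mW2.
have sub0 S S' : S `<=` S' -> mu (S `\` S') = 0.
  move=> SS'; rewrite (_ : _ `\` _ = set0) ?measure0//.
  by apply/seteqP; split=> // x [/SS'].
have r1le S S' : measurable S -> measurable S' -> S `<=` S' -> r1 S' `<=` r1 S.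
  move=> mS mS' SS' x [W1x nS'x]; split; last by move=> /SS'.
  exact: W1le (sub0 _ _ SS') _ W1x.
have r2le S S' : measurable S -> measurable S' -> S `<=` S' -> r2 S' `<=` r2 S.
  move=> mS mS' SS' x [W2x nS'x]; split; last by move=> /SS'.
  exact: W2le (sub0 _ _ SS') _ W2x.
have rmono S S' : measurable S -> measurable S' -> S `<=` S' ->
    r1 (r2 S) `<=` r1 (r2 S').
  by move=> mS mS' SS'; apply: r1le; [exact: mr2|exact: mr2|exact: r2le].
(* The postfixed points; the fixed point is the image of a maximal one. *)
pose C := [set S | measurable S /\ S `<=` r1 (r2 S)].
have [|S []//|S CS|S [mS Sle] maxS] := @exhaustion _ _ _ mu C.
- by exists set0; split.
- have mS n : measurable (S n) by case: (CS n).
  have mU : measurable (\bigcup_n S n) by exact: bigcupT_measurable.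
  split=> // x [n _ Sx]; have [_ /(_ x Sx)] := CS n.
  by apply: rmono => // y ?; exists n.
have mS2 := mr2 _ mS; have mS1 := mr1 _ mS2.
have N0 : mu (r1 (r2 S) `\` S) = 0 by apply: maxS; split=> //; exact: rmono.
exists (r1 (r2 S)), (r2 S); split => //.
apply/seteqP; split; last exact: r2le.
move=> x [W2x nSx]; split; last by move=> [_ nS2]; apply: nS2.
exact: W2le N0 _ W2x.
Qed.

End fixed_point.

Local Close Scope ereal_scope.

Theorem theorem4p2 (R : realType) (X : ptopologicalType)
  (polX : polish R X)
  (P : R.-pker (borel X) ~> (path_space X))
  (markovP : strong_markov P)
  (a1 a2 : payoff R (borel X))
  (adm1 : admissible P a1) (adm2 : admissible P a2)
  (mu : {sigma_finite_measure set (borel X) -> \bar R})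
  (p : nat -> X -> X -> R)
  (densP : transition_density P mu p)
  (ord1 : forall x, lead a1 x <= both a1 x <= follow a1 x)
  (ord2 : forall x, lead a2 x <= both a2 x <= follow a2 x)
  (super1 : forall x,
     supermartingale (P x) (fun t w => discount a1 t * follow a1 (w t)))
  (super2 : forall x,
     supermartingale (P x) (fun t w => discount a2 t * follow a2 (w t))) :
  sharp_inter_equilibria P a1 a2 !=set0.
Proof.
(* The region where a player wants to stop against [T]. *)
pose W a adm ord T := [set y |
  (best polX markovP densP (a := a) adm ord T y < (lead a y)%:E)%E].
have mW a adm ord T : measurable T -> measurable (W a adm ord T).
  move=> mT; apply: (measurable_lt_lead adm); exact: measurable_best.
have Wle a adm ord : (forall x,
    supermartingale (P x) (fun t w => (discount a t * follow a (w t))%R)) ->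
    forall T T', measurable T -> measurable T' -> mu (T `\` T') = 0%E ->
    W a adm ord T' `<=` W a adm ord T.
  move=> super T T' mT mT' N0 y; apply: le_lt_trans; exact: best_le.
have [S [T [mS mT SE TE]]] := antitone_fixed_point (@mW a1 adm1 ord1)
  (@mW a2 adm2 ord2) (@Wle a1 adm1 ord1 super1) (@Wle a2 adm2 ord2 super2).
have respE a adm ord T0 : W a adm ord T0 `\` T0 = response polX markovP densP adm ord T0.
  by apply/seteqP; split=> y [? ?]; split.
exists (S, T); split=> //=.
  by rewrite SE respE; exact: response_optimal.
by rewrite TE respE; exact: response_optimal.
Qed.
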